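(* Let $r \ge 1$ be the target rank, with $r \le m$ and $\lambda_{r+1}\neq 0$, and let $\ell_1 = 2r+1$ and $\ell_2 = 2\ell_1+1 = 4r+3$. Let $\Omega \in \mathbb{R}^{n\times \ell_1}$ and $\Psi\in\mathbb{R}^{m\times \ell_2}$ be independent standard Gaussian random matrices. Let $Y = A\Omega$ with thin QR factorization $Y = Q_Y R_Y$, let $Z = A^\top\Psi$, and let $$\widehat{A} = Q_Y(\Psi^\top Q_Y)^\dagger Z^\top, \qquad \widehat{H} = \widehat{A}^\top\widehat{A}$$ be the SingleView approximations of $A$ and of $H = A^\top A$. Define $$\Theta_{H}(r) = 4\left(\sum_{j>r}\lambda_1\lambda_j\right)^{1/2} + 4\sum_{j>r}\lambda_j = \left(\left(\frac{\lambda_1}{\lambda_{r+1}}\right)^{1/2}\mathrm{id}_r^{1/2} + \mathrm{id}_r\right)4\lambda_{r+1}, \qquad \mathrm{id}_r = \frac{\sum_{j>r}\lambda_j}{\lambda_{r+1}}.$$ Then the following bounds hold. 1. The error in the SketchSolv solution $\delta\widehat{x}$ satisfies $$\mathbb{E}\left[\frac{\|\delta x - \delta\widehat{x}\|_{\Gamma^{-1}}}{\|\delta x\|_{\Gamma^{-1}}}\right] \le \Theta_{H}(r).$$ 2. The condition number of the preconditioned operator satisfies $$\mathbb{E}\left[\sqrt{\kappa_2\left((I+\widehat{H})^{-1/2}(I+H)(I+\widehat{H})^{-1/2}\right)}\right] \le 1 + \Theta_{H}(r).$$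
   Context: Setting: $m \le n$; $A \in \mathbb{R}^{m\times n}$ is a fixed (deterministic) matrix with singular values $\sigma_1 \ge \dots \ge \sigma_m \ge 0$; $H = A^\top A \in \mathbb{R}^{n\times n}$ has eigenvalues $\lambda_j = \sigma_j^2$ for $1\le j\le m$ and $\lambda_j = 0$ for $m<j\le n$. (In the data assimilation application, $A$ is the matrix obtained by stacking the blocks $R_i^{-1/2} O_i M_i \Gamma^{1/2}$, where $M_i$, $O_i$ are the linearized model and observation operators and $R_i$ the observation error covariances, $i=1,\dots,n_t$.) $\Gamma \in \mathbb{R}^{n\times n}$ is symmetric positive definite (the prior covariance) and $g\in\mathbb{R}^n$ is a fixed nonzero vector (the gradient). Gauss-Newton Hessian: $\mathcal{H} = \Gamma^{-1/2}(I+H)\Gamma^{-1/2}$, and the exact step $\delta x$ is the solution of $\mathcal{H}\,\delta x = -g$. Given a symmetric positive semidefinite approximation $\widehat{H}$ of $H$, set $\widehat{\mathcal{H}} = \Gamma^{-1/2}(I+\widehat{H})\Gamma^{-1/2}$; the SketchSolv solution $\delta\widehat{x}$ is the solution of $\widehat{\mathcal{H}}\,\delta\widehat{x} = -g$, i.e. $\delta\widehat{x} = -\Gamma^{1/2}(I+\widehat{H})^{-1}\Gamma^{1/2} g$. Notation: $^\dagger$ is the Moore-Penrose inverse; $\|x\|_{M} = \|M^{1/2}x\|_2$ for symmetric positive definite $M$; $\kappa_2(M) = \|M\|_2\|M^{-1}\|_2$ for invertible $M$, with $\|\cdot\|_2$ the spectral norm. A standard Gaussian random matrix has i.i.d. $N(0,1)$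 entries. In a thin QR factorization $Y = Q_YR_Y$, the matrix $Q_Y$ has orthonormal columns and $\mathrm{range}(Y)\subseteq\mathrm{range}(Q_Y)$, and $Q_Y$ is determined by $Y$. Expectation is over $(\Omega,\Psi)$; exact arithmetic is assumed. *)

(* Defs.v *)
From HB Require Import structures.
From mathcomp Require Import all_boot all_order all_algebra.
From mathcomp Require Import all_classical all_reals all_analysis.

Set Implicit Arguments.
Unset Strict Implicit.
Unset Printing Implicit Defensive.

Import Order.TTheory GRing.Theory Num.Theory.
Import numFieldNormedType.Exports.

Local Open Scope classical_set_scope.
Local Open Scope ring_scope.

Section LinearAlgebra.
Variable R : realType.

Definition psdmx p (M : 'M[R]_p) : Prop :=
  M^T = M /\ forall x : 'cV[R]_p, 0 <= (x^T *m M *m x) 0 0.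

Definition spdmx p (M : 'M[R]_p) : Prop :=
  M^T = M /\ forall x : 'cV[R]_p, x != 0 -> 0 < (x^T *m M *m x) 0 0.

(* M^{1/2}: the unique positive semidefinite square root when M is positive
   semidefinite, and 0 if M has no such root. *)
Definition sqrtmx p (M : 'M[R]_p) : 'M[R]_p :=
  xget 0 [set B | psdmx B /\ B *m B = M].

(* The four Penrose conditions (over the reals), which determine X uniquely. *)
Definition is_moore_penrose p q (B : 'M[R]_(p, q)) (X : 'M[R]_(q, p)) : Prop :=
  [/\ B *m X *m B = B, X *m B *m X = X,
      (B *m X)^T = B *m X & (X *m B)^T = X *m B].

(* Not [pinvmx], which is only a partial inverse on the row space. *)
Definition moore_penrose p q (B : 'M[R]_(p, q)) : 'M[R]_(q, p) :=
  xget 0 [set X | is_moore_penrose B X].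

(* The library's norm on matrices is the entrywise maximum, hence the following
   definitions of the Euclidean and spectral norms. *)
Definition norm2 p (x : 'cV[R]_p) : R := Num.sqrt (\sum_i x i 0 ^+ 2).

Definition normM p (M : 'M[R]_p) (x : 'cV[R]_p) : R := norm2 (sqrtmx M *m x).

Definition spectral_norm p q (M : 'M[R]_(p, q)) : R :=
  sup [set norm2 (M *m x) | x in [set x : 'cV[R]_q | norm2 x <= 1]].

Definition kappa2 p (M : 'M[R]_p) : R :=
  spectral_norm M * spectral_norm (invmx M).

(* s lists the singular values of A in nonincreasing order: they are the
   diagonal entries of the middle factor of a singular value decomposition. *)
Definition is_singular_values m n (A : 'M[R]_(m, n)) (s : m.-tuple R) : Prop :=
  [/\ sorted (fun x y => y <= x) s,
      forall i : 'I_m, 0 <= tnth s i &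
      exists (U : 'M[R]_m) (V : 'M[R]_n),
        [/\ U^T *m U = 1%:M, V^T *m V = 1%:M &
            A = U *m (\matrix_(i, j) (tnth s i *+ (i == j :> nat))) *m V^T]].

(* Indices start at 1: for j > size s the default value 0 of the sequence
   gives lambda_j = 0. *)
Definition lambda (s : seq R) (j : nat) : R := s`_j.-1 ^+ 2.

Definition tail_sum (s : seq R) (n r : nat) : R :=
  \sum_(r.+1 <= j < n.+1) lambda s j.

Definition intdim (s : seq R) (n r : nat) : R :=
  tail_sum s n r / lambda s r.+1.

Definition ThetaH (s : seq R) (n r : nat) : R :=
  4 * Num.sqrt (\sum_(r.+1 <= j < n.+1) lambda s 1 * lambda s j)
  + 4 * tail_sum s n r.

(* Y = Q T with orthonormal columns in Q and T upper triangular (trapezoidal);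
   [is_trig_mx] means lower triangular. When Y is wide, Q is square. *)
Definition thin_qr m l (Y : 'M[R]_(m, l)) (Q : 'M[R]_(m, minn m l))
    (T : 'M[R]_(minn m l, l)) : Prop :=
  [/\ Q^T *m Q = 1%:M, is_trig_mx T^T & Y = Q *m T].

(* SingleView approximation of A from Y = A Omega and Z = A^T Psi; qf maps Y to
   the orthonormal factor of its thin QR factorization. *)
Definition singleview m n l1 l2 (A : 'M[R]_(m, n))
    (qf : 'M[R]_(m, l1) -> 'M[R]_(m, minn m l1))
    (Omega : 'M[R]_(n, l1)) (Psi : 'M[R]_(m, l2)) : 'M[R]_(m, n) :=
  let QY := qf (A *m Omega) in
  let Z := A^T *m Psi in
  QY *m moore_penrose (Psi^T *m QY) *m Z^T.

Definition gn_hessian n (Gamma H : 'M[R]_n) : 'M[R]_n :=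
  invmx (sqrtmx Gamma) *m (1%:M + H) *m invmx (sqrtmx Gamma).

Definition precond n (H Hhat : 'M[R]_n) : 'M[R]_n :=
  invmx (sqrtmx (1%:M + Hhat)) *m (1%:M + H) *m invmx (sqrtmx (1%:M + Hhat)).

(* Borel sets of p x q matrices, as the product sigma-algebra of the entries. *)
Definition borel_mx p q : set (set 'M[R]_(p, q)) :=
  <<s [set E | exists i j (B : set R),
         measurable B /\ E = [set M : 'M[R]_(p, q) | B (M i j)]] >>.

Definition borel_fun p q p' q' (f : 'M[R]_(p, q) -> 'M[R]_(p', q')) : Prop :=
  forall E, @borel_mx p' q' E -> @borel_mx p q (f @^-1` E).

End LinearAlgebra.

Section RandomMatrices.
Context (d : measure_display) (T : measurableType d) (R : realType).
Variable P : probability T R.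

Definition iid_entries p q (X : T -> 'M[R]_(p, q)) (D : set R -> \bar R) :=
  [/\ forall i j, measurable_fun [set: T] (fun w => X w i j),
      forall i j (B : set R), measurable B ->
        P [set w | B (X w i j)] = D B &
      forall B : 'I_p -> 'I_q -> set R, (forall i j, measurable (B i j)) ->
        P [set w | forall i j, B i j (X w i j)] =
        (\prod_(i < p) \prod_(j < q) P [set w | (B i j) (X w i j)])%E].

Definition std_gaussian_mx p q (X : T -> 'M[R]_(p, q)) : Prop :=
  iid_entries X (normal_prob 0 1).

Definition independent_mx p q p' q' (X : T -> 'M[R]_(p, q))
    (Y : T -> 'M[R]_(p', q')) : Prop :=
  forall E F, @borel_mx R p q E -> @borel_mx R p' q' F ->
    P (X @^-1` E `&` Y @^-1` F) = (P (X @^-1` E) * P (Y @^-1` F))%E.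

End RandomMatrices.

(* Main.v *)
Require Import Defs.
From HB Require Import structures.
From mathcomp Require Import all_boot all_order all_algebra.
From mathcomp Require Import all_classical all_reals all_analysis.
From mathcomp Require Import measurable_realfun.
From mathcomp Require sesquilinear spectral complex.
From mathcomp Require Import ring lra zify.

Set Implicit Arguments.
Unset Strict Implicit.
Unset Printing Implicit Defensive.
Import Order.TTheory GRing.Theory Num.Theory.
Import numFieldNormedType.Exports.
Local Open Scope classical_set_scope.
Local Open Scope ring_scope.

(* With e the Frobenius norm of A - Ahat and s1 the largest singular value of A,
   the matrix Ahat^T Ahat differs from A^T A by at most D = 2 s1 e + e^2 in the
   spectral norm. This gives the bound D for the relative error of the solution
   and 1 + D for the square root of the condition number, and it remains to show
   E[e^2] <= 4 tau, where tau is the sum of the trailing eigenvalues.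
   Given the orthonormal factor Q, the sketch Psi^T Q is Gaussian and independent
   of the part of Psi orthogonal to Q; conditionally on the former,
   E[e^2] = |(1 - Q Q^T) A|^2 (1 + E[tr ((G^T G)^-1)]) with G Gaussian. The same
   computation with Omega and the leading right singular vectors V instead of Psi
   and Q bounds E[|(1 - Q Q^T) A|^2], because the range of Q contains that of
   A Omega. A diagonal entry of (G^T G)^-1 is the inverse of a chi-square variable:
   triangularize the other columns of G by plane rotations, which preserve the
   Gaussian law, and use 1 / S = int_0^oo exp(- t S) dt. The dimensions 2 r + 1
   and 4 r + 3 make both factors at most 2. *)

(** Conditioning is expressed by resampling: a Gaussian matrix has the same law as the matrix that
    keeps the entries in a set [S] and takes the others from an independent copy, so a conditional
    mean becomes an inner integral. Rotation invariance is proved for plane rotations, so an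
    orthogonal matrix that acts on a Gaussian one is always built as a product of such rotations.
    The inverse Gram matrix is a rational function of the entries, hence measurable; adding e > 0 to
    the Gram matrix shows that the singular event is null, and there the error bound is set to
    infinity, so that it holds at every outcome. For a Gaussian G with a + n + 2 rows and a columns
    the mean trace is at most a / (n + 1): this is r / r for 2 r + 1 rows and r columns, and at most
    1 for 4 r + 3 rows and at most 2 r + 1 columns. The term linear in e is replaced by an affine
    function of e^2, by AM-GM at sqrt (4 tau), so that a bound on E[e^2] suffices; tau > 0 because
    lambda_(r+1) is nonzero. *)

(** * Integration against the standard normal law through its density *)

Section NormalIntegral.
Variable R : realType.
Local Notation mu := (@lebesgue_measure R).
Local Notation gam := (normal_prob (0 : R) 1).

Lemma integral_normal_indic (A : set (measurableTypeR R)) : measurable A ->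
  (\int[gam]_x (\1_A x)%:E =
   \int[mu]_x ((\1_A x)%:E * (normal_pdf 0 1 x)%:E))%E.
Proof.
move=> mA; rewrite integral_indic// setIT.
transitivity (\int[mu]_(x in A) (normal_pdf 0 1 x)%:E)%E; first by [].
rewrite integral_mkcond; apply: eq_integral => x _; rewrite patchE indicE.
by case: ifPn => xA; rewrite ?mul1e ?mul0e.
Qed.

Import HBNNSimple.

(** Increasing simple approximations and monotone convergence on both sides reduce the claim to
    indicators. *)
Lemma ge0_integral_normal (f : measurableTypeR R -> \bar R) :
  measurable_fun setT f -> (forall x, 0 <= f x)%E ->
  (\int[gam]_x f x = \int[mu]_x (f x * (normal_pdf 0 1 x)%:E))%E.
Proof.
move=> mf f0; pose f_ := nnsfun_approx measurableT mf.
have mpdf : measurable_fun setT (fun x : measurableTypeR R => (normal_pdf 0 1 x)%:E).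
  by apply/measurable_EFinP; exact: measurable_normal_pdf.
have pdf0 x : (0 <= (normal_pdf (0 : R) 1 x)%:E)%E.
  by rewrite lee_fin normal_pdf_ge0.
transitivity (limn (fun n => \int[gam]_x (f_ n x)%:E)%E).
  rewrite -monotone_convergence//.
  - apply: eq_integral => y _; apply/esym/cvg_lim => //.
    exact: cvg_nnsfun_approx.
  - by move=> n; apply/measurable_EFinP; exact: measurable_funP.
  - by move=> n y _; rewrite lee_fin.
  - by move=> y _ m n mn; rewrite lee_fin; exact/lefP/nd_nnsfun_approx.
transitivity (limn (fun n => \int[mu]_x ((f_ n x)%:E * (normal_pdf 0 1 x)%:E))%E); last first.
  rewrite -monotone_convergence//.
  - apply: eq_integral => y _; apply/cvg_lim => //.
    apply: cvgeZr => //.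
    exact: cvg_nnsfun_approx.
  - by move=> n; apply: emeasurable_funM => //; apply/measurable_EFinP; exact: measurable_funP.
  - by move=> n y _; rewrite mule_ge0// lee_fin.
  - by move=> y _ m n mn; rewrite lee_wpmul2r// lee_fin; exact/lefP/nd_nnsfun_approx.
congr (limn _); apply/funext => n.
transitivity (\int[gam]_x (\sum_(r \in range (f_ n)) (r%:E * (\1_((f_ n) @^-1` [set r]) x)%:E)))%E.
  by apply: eq_integral => x _; rewrite fimfunE -fsumEFin.
transitivity (\int[mu]_x (\sum_(r \in range (f_ n)) (r%:E * ((\1_((f_ n) @^-1` [set r]) x)%:E * (normal_pdf 0 1 x)%:E))))%E; last first.
  apply: eq_integral => x _.
  rewrite fimfunE -fsumEFin// ge0_mule_fsuml; last first.
    by move=> r; rewrite EFinM nnfun_muleindic_ge0.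
  by apply: eq_fsbigr => r _; rewrite EFinM muleA.
have ge0 r x : (0 <= r%:E * (\1_((f_ n) @^-1` [set r]) x)%:E)%E.
  exact: nnfun_muleindic_ge0.
rewrite ge0_integral_fsum//; last by move=> r; apply: emeasurable_funM => //; apply/measurable_EFinP.
rewrite ge0_integral_fsum//; last 2 first.
- by move=> r; apply: emeasurable_funM => //; apply: emeasurable_funM => //; apply/measurable_EFinP.
- by move=> r x _; rewrite muleA mule_ge0.
apply: eq_fsbigr => r /set_mem [x _ <-].
have fx0 : (0 <= f_ n x)%R by [].
rewrite ge0_integralZl//; last exact/measurable_EFinP.
rewrite ge0_integralZl//; first by rewrite integral_normal_indic.
- by apply: emeasurable_funM => //; apply/measurable_EFinP.
- by move=> y _; rewrite mule_ge0// lee_fin.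
Qed.

End NormalIntegral.

(** * Invariance of planar Lebesgue integrals under shears and rotations *)

Section Shears.
Variable R : realType.
Local Notation mu := (@lebesgue_measure R).
Local Notation MR := (measurableTypeR R).

Lemma measurable_translation (a : R) : measurable_fun setT (fun x : MR => (x + a : MR)).
Proof. exact: measurable_funD. Qed.

Lemma lebesgue_measure_translation (a : R) (A : set MR) : measurable A ->
  pushforward mu (fun x : MR => (x + a : MR)) A = mu A.
Proof.
move=> mA.
pose F : {mfun MR >-> MR} := HB.pack (fun x : MR => (x + a : MR))
  (isMeasurableFun.Build _ _ _ _ _ (measurable_translation a)).
rewrite -[LHS]/(pushforward mu F A).
apply/esym/lebesgue_measure_unique => //= _ [[x y]] _ <-.
rewrite /pushforward.
rewrite (_ : _ @^-1` _ = `](x - a), (y - a)]%classic); last first.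
  apply/seteqP; split => z /=; rewrite !in_itv/= => /andP[? ?]; apply/andP; split.
  - by rewrite ltrBlDr.
  - by rewrite lerBrDr.
  - by rewrite -ltrBlDr.
  - by rewrite -lerBrDr.
rewrite !lebesgue_measure_itv/= !lte_fin ltrD2r.
by case: ifP => //; rewrite -!EFinB; move=> _; congr EFin; ring.
Qed.

Lemma integral_translation (f : MR -> \bar R) (a : R) :
  measurable_fun setT f -> (forall x, 0 <= f x)%E ->
  (\int[mu]_x f (x + a)%R = \int[mu]_x f x)%E.
Proof.
move=> mf f0.
have ma : measurable_fun setT (fun x : MR => (x + a : MR)).
  exact: measurable_translation.
transitivity (\int[pushforward mu (fun x : MR => (x + a : MR)%R)]_x f x)%E.
  by rewrite ge0_integral_pushforward//= preimage_setT.
by apply: eq_measure_integral => A mA _; exact: lebesgue_measure_translation.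
Qed.

(** Written as an iterated integral so that a shear of the inner variable is, for each value of the
    outer one, a translation. *)
Definition iint (G : MR * MR -> \bar R) := (\int[mu]_x \int[mu]_y G (x, y))%E.

Lemma iint_shearr (G : MR * MR -> \bar R) (t : R) :
  measurable_fun setT G -> (forall z, 0 <= G z)%E ->
  iint (fun z => G (z.1, z.2 + t * z.1)) = iint G.
Proof.
move=> mG G0; apply: eq_integral => x _ /=.
rewrite (@integral_translation (fun y => G (x, y)))//.
by apply: measurableT_comp => //; exact: measurable_pair1.
Qed.

Lemma measurable_shearl (t : R) :
  measurable_fun setT (fun z : MR * MR => ((z.1 + t * z.2, z.2) : MR * MR)).
Proof.
apply: measurable_fun_pair => //.
by apply: measurable_funD => //; apply: measurable_funM => //.
Qed.

Lemma measurable_shearr (t : R) :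
  measurable_fun setT (fun z : MR * MR => ((z.1, z.2 + t * z.1) : MR * MR)).
Proof.
apply: measurable_fun_pair => //.
by apply: measurable_funD => //; apply: measurable_funM => //.
Qed.

(** Here the outer variable moves, so Tonelli exchanges the order before and after the
    translation. *)
Lemma iint_shearl (G : MR * MR -> \bar R) (t : R) :
  measurable_fun setT G -> (forall z, 0 <= G z)%E ->
  iint (fun z => G (z.1 + t * z.2, z.2)) = iint G.
Proof.
move=> mG G0; rewrite /iint.
have mG' : measurable_fun setT (fun z : MR * MR => G (z.1 + t * z.2, z.2)).
  by apply: (measurableT_comp mG); exact: measurable_shearl.
have G0' z : (0 <= G (z.1 + t * z.2, z.2)%R)%E by exact: G0.
have e1 := @fubini_tonelli _ _ _ _ R mu mu _ mG' G0'.
have e2 := @fubini_tonelli _ _ _ _ R mu mu _ mG G0.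
apply: (etrans e1); apply: (etrans _ (esym e2)).
rewrite /fubini_G/=.
apply: eq_integral => y _.
rewrite (@integral_translation (fun x => G (x, y)))//.
by apply: measurableT_comp => //; exact: measurable_pair2.
Qed.

(* A rotation with nonzero sine is a product of three shears. *)
Lemma iint_rot (G : MR * MR -> \bar R) (c s : R) :
  c ^+ 2 + s ^+ 2 = 1 -> s != 0 ->
  measurable_fun setT G -> (forall z, 0 <= G z)%E ->
  iint (fun z => G (c * z.1 + s * z.2, - s * z.1 + c * z.2)) = iint G.
Proof.
(* For [c] and [s] the cosine and sine of an angle, [a] is the tangent of half the angle. The shears
   are x += a y, then y -= s x, then x += a y, and a (1 + c) = s. *)
move=> cs s0 mG G0; pose a := (1 - c) / s.
pose G1 z := G (z.1 + a * z.2, z.2).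
pose G2 (z : MR * MR) := G1 (z.1, z.2 + (- s) * z.1).
have mG1 : measurable_fun setT G1.
  by apply: (measurableT_comp mG); exact: measurable_shearl.
have mG2 : measurable_fun setT G2.
  by apply: (measurableT_comp mG1); exact: measurable_shearr.
have G10 z : (0 <= G1 z)%E by exact: G0.
have G20 z : (0 <= G2 z)%E by exact: G0.
transitivity (iint G1); last exact: (iint_shearl a mG G0).
transitivity (iint G2); last exact: (iint_shearr (- s) mG1 G10).
transitivity (iint (fun z => G2 (z.1 + a * z.2, z.2))); last first.
  exact: (iint_shearl a mG2 G20).
congr iint; apply/funext => -[x y]; rewrite /G2 /G1 /=.
have cc : (1 - c) * (1 + c) = s ^+ 2.
  by rewrite -(addKr (c ^+ 2) (s ^+ 2)) cs; ring.
congr (G (_, _)); rewrite /a.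
  have -> : s * y = (1 - c) / s * (1 + c) * y.
    by congr (_ * y); rewrite mulrAC cc expr2 mulfK.
  by field.
by field.
Qed.

End Shears.

(** * Rotation invariance of the standard normal law of the plane *)

Section Rotation.
Variable R : realType.
Local Notation mu := (@lebesgue_measure R).
Local Notation MR := (measurableTypeR R).
Local Notation gam := (normal_prob (0 : R) 1).
Local Notation phi x := (normal_pdf (0 : R) 1 x).

Lemma normal_pdf_rot (c s x y : R) : c ^+ 2 + s ^+ 2 = 1 ->
  phi (c * x + s * y) * phi (- s * x + c * y) = phi x * phi y.
Proof.
move=> cs; rewrite /normal_pdf oner_eq0 /normal_fun.
rewrite mulrACA [in RHS]mulrACA -!expRD; congr (_ * expR _).
rewrite !subr0 expr1n -!mulrDl; congr (_ / _).
by rewrite -[LHS]opprK -[RHS]opprK; congr (- _); rewrite -[RHS]mul1r -cs; ring.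
Qed.

Lemma normal_prod_iint (E : set (MR * MR)) : measurable E ->
  (gam \x gam)%E E = iint (fun z : MR * MR => ((\1_E z)%:E * (phi z.1 * phi z.2)%:E)%E).
Proof.
move=> mE; rewrite /product_measure1.
rewrite ge0_integral_normal//; last exact: measurable_fun_xsection.
apply: eq_integral => x _ /=.
rewrite -[gam (xsection E x)]/(\int[mu]_(y in xsection E x) (phi y)%:E)%E.
rewrite integral_mkcond -ge0_integralZr//; last 3 first.
- apply/measurable_restrict => //; first exact: measurable_xsection.
  by apply/measurable_funTS/measurable_EFinP; exact: measurable_normal_pdf.
- by move=> y _; apply: erestrict_ge0 => z _; rewrite lee_fin normal_pdf_ge0.
- by rewrite lee_fin normal_pdf_ge0.
apply: eq_integral => y _; rewrite patchE indicE mem_xsection.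
by case: ifPn; rewrite ?mul0e// mul1e muleC EFinM.
Qed.

(** Both the planar integral and the product density are unchanged by the rotation, so the rotated
    coordinates are again independent and standard normal. *)
Lemma normal_prod_rot (c s : R) (A B : set MR) : c ^+ 2 + s ^+ 2 = 1 -> s != 0 ->
  measurable A -> measurable B ->
  (gam \x gam)%E [set z : MR * MR | A (c * z.1 + s * z.2) /\ B (- s * z.1 + c * z.2)] =
  (gam A * gam B)%E.
Proof.
move=> cs s0 mA mB.
pose rot (z : MR * MR) : MR * MR := (c * z.1 + s * z.2, - s * z.1 + c * z.2).
have mrot : measurable_fun setT rot.
  by apply: measurable_fun_pair; apply: measurable_funD; apply: measurable_funM.
have mE : measurable (A `*` B) by exact: measurableX.
have mR : measurable (rot @^-1` (A `*` B)).
  by rewrite -[X in measurable X]setTI; exact: mrot.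
pose G (z : MR * MR) := ((\1_(A `*` B) z)%:E * (phi z.1 * phi z.2)%:E)%E.
have mG : measurable_fun setT G.
  apply: emeasurable_funM; first exact/measurable_EFinP.
  apply/measurable_EFinP; apply: measurable_funM.
    by apply: measurableT_comp => //; exact: measurable_normal_pdf.
  by apply: measurableT_comp => //; exact: measurable_normal_pdf.
have G0 z : (0 <= G z)%E.
  by rewrite mule_ge0// lee_fin// mulr_ge0// normal_pdf_ge0.
apply: (etrans _ (product_measure1E gam gam mA mB)).
apply: (etrans (normal_prod_iint mR)).
apply: (etrans _ (esym (normal_prod_iint mE))).
apply: (etrans _ (iint_rot cs s0 mG G0)).
by congr iint; apply/funext => -[x y]; rewrite /G /= normal_pdf_rot.
Qed.

End Rotation.

(** * The Borel sigma-algebra on matrices *)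

Section MatrixMeasurable.
Variable R : realType.

Definition mxgen p q : set (set 'M[R]_(p, q)) :=
  [set E | exists i j (B : set R),
     measurable B /\ E = [set M : 'M[R]_(p, q) | B (M i j)]].

Definition mxrect p q (B : 'I_p -> 'I_q -> set R) : set 'M[R]_(p, q) :=
  [set M | forall i j, B i j (M i j)].

(** Unlike the one-entry cylinders in [mxgen], these sets are closed under intersection, so two laws
    that agree on them coincide. *)
Definition mxrects p q : set (set 'M[R]_(p, q)) :=
  [set E | exists2 B : 'I_p -> 'I_q -> set R,
     (forall i j, measurable (B i j)) & E = mxrect B].

End MatrixMeasurable.

Notation mxT R p q := (g_sigma_algebraType (@mxgen R p q)).

Section MatrixMeasurableTheory.
Variable R : realType.

Lemma measurable_entry p q (i : 'I_p) (j : 'I_q) :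
  measurable_fun setT (fun M : mxT R p q => M i j).
Proof.
move=> _ B mB; rewrite setTI; apply: sub_sigma_algebra.
by exists i, j, B.
Qed.

Lemma measurable_mx d (T : measurableType d) p q (X : T -> mxT R p q) :
  (forall i j, measurable_fun setT (fun w => X w i j)) -> measurable_fun setT X.
Proof.
move=> mX; apply: (@measurability _ _ _ (mxT R p q) _ _ (@mxgen R p q)) => //.
by move=> _ [_ [i [j [B [mB ->]]]] <-]; exact: mX.
Qed.

Lemma measurable_mxE d (T : measurableType d) p q (X : T -> mxT R p q) i j :
  measurable_fun setT X -> measurable_fun setT (fun w => X w i j).
Proof. by move=> mX; exact: (measurableT_comp (measurable_entry i j)). Qed.

Lemma mxrects_setI p q : setI_closed (@mxrects R p q).
Proof.
move=> _ _ [B mB ->] [C mC ->]; exists (fun i j => B i j `&` C i j).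
  by move=> i j; exact: measurableI.
apply/seteqP; split => [M [BM CM] i j|M BCM]; first by split.
by split => i j; have [] := BCM i j.
Qed.

Lemma mxrect_setT p q : @mxrect R p q (fun _ _ => setT) = setT.
Proof. by apply/seteqP; split. Qed.

Lemma measurable_mxrect p q (B : 'I_p -> 'I_q -> set R) :
  (forall i j, measurable (B i j)) -> measurable (mxrect B : set (mxT R p q)).
Proof.
move=> mB.
rewrite (_ : mxrect B = \bigcap_(i in [set: 'I_p]) \bigcap_(j in [set: 'I_q])
    ((fun M : mxT R p q => M i j) @^-1` B i j)).
  apply: fin_bigcap_measurable => [|i _]; first exact: finite_finset.
  apply: fin_bigcap_measurable => [|j _]; first exact: finite_finset.
  by rewrite -[X in measurable X]setTI; exact: measurable_entry.
by apply/seteqP; split => M BM i => [_ j _|j]; exact: BM.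
Qed.

Lemma mxT_rects p q : (measurable : set (set (mxT R p q))) = <<s @mxrects R p q >>.
Proof.
apply/seteqP; split; last first.
  apply: smallest_sub; first exact: sigma_algebra_measurable.
  by move=> _ [B mB ->]; exact: measurable_mxrect.
apply: smallest_sub; first exact: smallest_sigma_algebra.
move=> _ [i [j [B [mB ->]]]]; apply: sub_sigma_algebra.
exists (fun i' j' => if (i' == i) && (j' == j) then B else setT).
  by move=> i' j'; case: ifP.
apply/seteqP; split => [M /= BM i' j'|M /(_ i j)]; last by rewrite !eqxx.
by case: ifPn => // /andP[/eqP-> /eqP->].
Qed.

End MatrixMeasurableTheory.

(** * Laws of Gaussian matrices: uniqueness, resampling, reindexing, signs *)

Section GaussianMatrix.
Variable R : realType.
Local Notation gam := (normal_prob (0 : R) 1).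

(** The law is prescribed by one product formula on rectangles, so that each invariance below is
    checked on rectangles only. *)
Definition gmx d (T : measurableType d) (P : set T -> \bar R) p q
    (X : T -> 'M[R]_(p, q)) :=
  (forall i j, measurable_fun setT (fun w => X w i j)) /\
  forall B : 'I_p -> 'I_q -> set R, (forall i j, measurable (B i j)) ->
    P (X @^-1` mxrect B) = (\prod_(i < p) \prod_(j < q) gam (B i j))%E.

Lemma std_gaussian_gmx d (T : measurableType d) (P : probability T R) p q
    (X : T -> 'M[R]_(p, q)) : std_gaussian_mx P X -> gmx P X.
Proof.
move=> [mX gX iX]; split=> // B mB.
rewrite -[_ @^-1` _]/[set w | forall i j, B i j (X w i j)] iX//.
by apply: eq_bigr => i _; apply: eq_bigr => j _; rewrite gX.
Qed.

Lemma normal_setT : gam setT = 1%E.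
Proof. exact: probability_setT. Qed.

Section Law.
Context d (T : measurableType d) (P : {measure set T -> \bar R}).
Context p q (X : T -> 'M[R]_(p, q)) (gX : gmx P X).

Lemma gmx_measurable : measurable_fun setT (X : T -> mxT R p q).
Proof. by case: gX => mX _; exact: measurable_mx. Qed.

Lemma gmx_setT : P setT = 1%E.
Proof.
case: gX => _ /(_ (fun _ _ => setT)); rewrite mxrect_setT preimage_setT => -> //.
by rewrite big1// => i _; rewrite big1// => j _; exact: normal_setT.
Qed.

End Law.

Section LawUnique.
Context d (T : measurableType d) (P : {measure set T -> \bar R}).
Context d' (T' : measurableType d') (P' : {measure set T' -> \bar R}).
Context p q (X : T -> 'M[R]_(p, q)) (gX : gmx P X).
Context (X' : T' -> 'M[R]_(p, q)) (gX' : gmx P' X').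

Lemma gmx_law (E : set (mxT R p q)) : measurable E ->
  P (X @^-1` E) = P' (X' @^-1` E).
Proof.
move=> mE.
pose F : {mfun T >-> mxT R p q} := HB.pack (X : T -> mxT R p q)
  (isMeasurableFun.Build _ _ _ _ _ (gmx_measurable gX)).
pose F' : {mfun T' >-> mxT R p q} := HB.pack (X' : T' -> mxT R p q)
  (isMeasurableFun.Build _ _ _ _ _ (gmx_measurable gX')).
rewrite -[LHS]/(pushforward P F E) -[RHS]/(pushforward P' F' E).
apply: (@measure_unique _ R (mxT R p q) (@mxrects R p q) (fun=> setT)) => //.
- exact: mxT_rects.
- exact: mxrects_setI.
- by move=> _; exists (fun _ _ => setT) => //; rewrite mxrect_setT.
- exact: bigcup_const.
- move=> _ [B mB ->]; exact: (etrans (gX.2 B mB) (esym (gX'.2 B mB))).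
- by move=> _; rewrite -[X in (X < _)%E]/(P setT) (gmx_setT gX) ltry.
Qed.

Lemma gmx_integral (f : mxT R p q -> \bar R) :
  measurable_fun setT f -> (forall M, 0 <= f M)%E ->
  (\int[P]_w f (X w) = \int[P']_w f (X' w))%E.
Proof.
move=> mf f0.
pose F : {mfun T >-> mxT R p q} := HB.pack (X : T -> mxT R p q)
  (isMeasurableFun.Build _ _ _ _ _ (gmx_measurable gX)).
pose F' : {mfun T' >-> mxT R p q} := HB.pack (X' : T' -> mxT R p q)
  (isMeasurableFun.Build _ _ _ _ _ (gmx_measurable gX')).
transitivity (\int[pushforward P F]_M f M)%E.
  by rewrite [RHS](ge0_integral_pushforward (gmx_measurable gX)).
transitivity (\int[pushforward P' F']_M f M)%E; last first.
  by rewrite [LHS](ge0_integral_pushforward (gmx_measurable gX')).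
by apply: eq_measure_integral => E mE _; exact: gmx_law.
Qed.

End LawUnique.

(** With [M] and [N] independent copies, this freezes the entries in [S] and redraws the others. *)
Definition mixmx p q (S : 'I_p -> 'I_q -> bool) (M N : 'M[R]_(p, q)) : 'M[R]_(p, q) :=
  \matrix_(i, j) if S i j then M i j else N i j.

Section Mix.
Context d (T : measurableType d) (P : probability T R).
Context d' (T' : measurableType d') (P' : probability T' R).
Context p q (X : T -> 'M[R]_(p, q)) (gX : gmx P X).
Context (X' : T' -> 'M[R]_(p, q)) (gX' : gmx P' X').

Lemma gmx_mix S :
  gmx (P \x P')%E (fun z => mixmx S (X z.1) (X' z.2)).
Proof.
split=> [i j|B mB].
  under eq_fun do rewrite mxE.
  case: (S i j).
    by apply: (measurableT_comp (gX.1 i j)).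
  by apply: (measurableT_comp (gX'.1 i j)).
pose B1 i j := if S i j then B i j else setT.
pose B2 i j := if S i j then setT else B i j.
rewrite (_ : _ @^-1` _ = (X @^-1` mxrect B1) `*` (X' @^-1` mxrect B2)); last first.
  apply/seteqP; split => [[x y]/= h|[x y]/= [h1 h2]].
    by split=> i j; have := h i j; rewrite mxE /B1 /B2; case: (S i j).
  by move=> i j; have := h1 i j; have := h2 i j; rewrite mxE /B1 /B2; case: (S i j).
have mB1 i j : measurable (B1 i j) by rewrite /B1; case: ifP.
have mB2 i j : measurable (B2 i j) by rewrite /B2; case: ifP.
rewrite product_measure1E; last 2 first.
- rewrite -[X in measurable X]setTI.
  by apply: (gmx_measurable gX) => //; exact: measurable_mxrect.
- rewrite -[X in measurable X]setTI.
  by apply: (gmx_measurable gX') => //; exact: measurable_mxrect.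
apply: (etrans (congr2 mule (gX.2 _ mB1) (gX'.2 _ mB2))).
rewrite -big_split/=.
apply: eq_bigr => i _; rewrite -big_split/=; apply: eq_bigr => j _.
by rewrite /B1 /B2; case: ifP => _; rewrite normal_setT ?mule1 ?mul1e.
Qed.

End Mix.

Section Resample.
Context d (T : measurableType d) (P : probability T R).
Context p q (X : T -> 'M[R]_(p, q)) (gX : gmx P X).

(** This plays the role of the conditional expectation given the entries in [S]: the mixture of two
    independent copies has the law of [X], and Tonelli splits its integral. *)
Lemma gmx_resample S (f : mxT R p q -> \bar R) :
  measurable_fun setT f -> (forall M, 0 <= f M)%E ->
  (\int[P]_w f (X w) = \int[P]_w \int[P]_w' f (mixmx S (X w) (X w')))%E.
Proof.
move=> mf f0; rewrite (gmx_integral gX (gmx_mix gX gX S))//.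
rewrite fubini_tonelli1//.
apply: (measurableT_comp mf).
exact: (gmx_measurable (gmx_mix gX gX S)).
Qed.

(** The two equivalences say that [E] looks only at the entries in [S] and [F] only at the others;
    for the mixture the joint event is then a product set. *)
Lemma gmx_indep S (E F : set (mxT R p q)) : measurable E -> measurable F ->
  (forall M N, E (mixmx S M N) <-> E M) ->
  (forall M N, F (mixmx S M N) <-> F N) ->
  P (X @^-1` (E `&` F)) = (P (X @^-1` E) * P (X @^-1` F))%E.
Proof.
move=> mE mF SE SF.
have mX (A : set (mxT R p q)) : measurable A -> measurable (X @^-1` A).
  by move=> mA; rewrite -[Y in measurable Y]setTI; exact: (gmx_measurable gX).
rewrite (gmx_law gX (gmx_mix gX gX S)); last exact: measurableI.
rewrite -product_measure1E; [|exact: mX|exact: mX].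
congr ((P \x P)%E _); apply/seteqP; split => -[x y] /= [].
  by move=> /SE ? /SF.
by move=> ? ?; split; [apply/SE|apply/SF].
Qed.

End Resample.

Section Reindex.
Context d (T : measurableType d) (P : set T -> \bar R).

Lemma gmx_reindex p q p' q' (X : T -> 'M[R]_(p, q))
    (h : 'I_p' * 'I_q' -> 'I_p * 'I_q) : injective h -> gmx P X ->
  gmx P (fun w => \matrix_(i, j) X w (h (i, j)).1 (h (i, j)).2).
Proof.
move=> hI [mX gX]; split=> [i j|B mB].
  by under eq_fun do rewrite mxE; exact: mX.
(* The rectangle is pulled back along [h]; positions outside the image of [h] are unconstrained and
   contribute a factor one. *)
pose B' k l := if [pick ij | h ij == (k, l)] is Some ij then B ij.1 ij.2 else setT.
have B'h ij : B' (h ij).1 (h ij).2 = B ij.1 ij.2.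
  rewrite /B'; case: pickP => [x /eqP|/(_ ij)]; rewrite -surjective_pairing ?eqxx//.
  by move=> /hI ->.
rewrite (_ : _ @^-1` _ = X @^-1` mxrect B'); last first.
  apply/seteqP; split => x /= h1 i j.
    rewrite /B'; case: pickP => // -[k l] /eqP hkl.
    by have := h1 k l; rewrite mxE hkl.
  by have := h1 (h (i, j)).1 (h (i, j)).2; rewrite B'h mxE.
rewrite gX; last by move=> i j; rewrite /B'; case: pickP.
rewrite !pair_big/=.
rewrite (bigID (fun kl => kl \in codom h))/= [X in (_ * X)%E]big1 ?mule1; last first.
  move=> [k l] /= kl; rewrite /B'; case: pickP => [ij /eqP hij|_]; last exact: normal_setT.
  by rewrite -hij codom_f in kl.
rewrite -big_uniq/=; last by rewrite map_inj_uniq ?enum_uniq.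
by rewrite big_map big_enum/=; apply: eq_bigr => ij _; rewrite B'h.
Qed.

End Reindex.

(** The quarter turn sends (x, y) to (y, -x), so the symmetry of the normal law is a case of
    rotation invariance. *)
Lemma normal_probN (B : set R) : measurable B -> gam (-%R @^-1` B) = gam B.
Proof.
move=> mB; have mT := @measurableT _ (measurableTypeR R).
have h01 : (0 : R) ^+ 2 + 1 ^+ 2 = 1 by rewrite expr0n expr1n add0r.
have := normal_prod_rot h01 (oner_neq0 _) mT mB.
rewrite normal_setT mul1e => <-.
have mNB : measurable (-%R @^-1` B : set (measurableTypeR R)).
  by rewrite -[Y in measurable Y]setTI; exact: (@measurable_funN _ _ _ setT id).
have e : (gam \x gam)%E ((-%R @^-1` B) `*` setT) = gam (-%R @^-1` B).
  apply: (etrans (product_measure1E gam gam mNB mT)).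
  by apply: (etrans (congr1 (mule _) normal_setT)); rewrite mule1.
apply: (etrans (esym e)).
congr ((_ \x _)%E _); apply/seteqP; split => -[x y] /=.
  by move=> [? _]; split => //; rewrite mul0r addr0 mulN1r.
by rewrite mul0r addr0 mulN1r => -[_ ?]; split.
Qed.

Section Signs.
Context d (T : measurableType d) (P : set T -> \bar R).

Lemma gmx_sign p q (X : T -> 'M[R]_(p, q)) (b : 'I_p -> 'I_q -> bool) :
  gmx P X -> gmx P (fun w => \matrix_(i, j) if b i j then - X w i j else X w i j).
Proof.
move=> [mX gX]; split=> [i j|B mB].
  by under eq_fun do rewrite mxE; case: (b i j); [exact: (measurable_funN (mX i j))|exact: mX].
pose B' i j := if b i j then -%R @^-1` B i j else B i j.
rewrite (_ : _ @^-1` _ = X @^-1` mxrect B'); last first.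
  apply/seteqP; split => x /= h1 i j; have := h1 i j; rewrite mxE /B';
  by case: ifP.
have mB' i j : measurable (B' i j).
  rewrite /B'; case: ifP => // _.
  by rewrite -[Y in measurable Y]setTI; exact: (@measurable_funN _ _ _ setT id).
rewrite gX//; apply: eq_bigr => i _; apply: eq_bigr => j _.
by rewrite /B'; case: ifP => // _; exact: normal_probN.
Qed.

End Signs.

End GaussianMatrix.

(** * Plane rotations of Gaussian matrices and triangularization *)

Section Givens.
Variable R : realType.
Local Notation gam := (normal_prob (0 : R) 1).
Local Notation MR := (measurableTypeR R).

Lemma prode2 p q (F F' : 'I_p -> 'I_q -> \bar R) (a b : 'I_p) (j : 'I_q) :
  a != b -> F' a j = 1%E -> F' b j = 1%E ->
  (forall i k, (i, k) != (a, j) -> (i, k) != (b, j) -> F' i k = F i k) ->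
  (\prod_(i < p) \prod_(k < q) F i k =
   (\prod_(i < p) \prod_(k < q) F' i k) * (F a j * F b j))%E.
Proof.
move=> ab Fa Fb FF'; rewrite !pair_big/=.
have ab' : (b, j) != (a, j) by rewrite xpair_eqE negb_and eq_sym ab.
rewrite (bigD1 (a, j))//= (bigD1 (b, j))//=.
rewrite [X in (_ = X * _)%E](bigD1 (a, j))//= [X in (_ = (_ * X) * _)%E](bigD1 (b, j))//=.
rewrite Fa Fb !mul1e muleA [RHS]muleC; congr (_ * _)%E.
by apply: eq_bigr => -[i k] /= /andP[h1 h2]; rewrite FF'.
Qed.

(** The rotation acts in column [j] alone, hence on two entries only, where the planar result
    applies. *)
Definition rotmx1 p q (a b : 'I_p) (j : 'I_q) (c s : R) (M : 'M[R]_(p, q)) :=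
  \matrix_(i, k) if k == j then
      if i == a then c * M a j + s * M b j
      else if i == b then - s * M a j + c * M b j else M i k
    else M i k.

Section Rot1.
Context d (T : measurableType d) (P : probability T R).
Context p q (X : T -> 'M[R]_(p, q)) (gX : gmx P X).
Variables (a b : 'I_p) (j : 'I_q).
Hypothesis ab : a != b.

Let pairX w : MR * MR := (X w a j, X w b j).

Let measurable_pairX : measurable_fun setT pairX.
Proof. by apply: measurable_fun_pair; exact: gX.1. Qed.

Let off (i : 'I_p) (k : 'I_q) := ~~ ((k == j) && ((i == a) || (i == b))).

Lemma gmx_pair (E : set (MR * MR)) : measurable E ->
  P (pairX @^-1` E) = (gam \x gam)%E E.
Proof.
move=> mE.
pose F : {mfun T >-> (MR * MR)%type} := HB.pack pairX
  (isMeasurableFun.Build _ _ _ _ _ measurable_pairX).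
rewrite -[LHS]/(pushforward P F E); apply: esym.
apply: product_measure_unique => // A B mA mB.
pose C i k := if k == j then if i == a then A else if i == b then B else setT else setT.
have mC i k : measurable (C i k).
  by rewrite /C; case: ifP => // _; case: ifP => // _; case: ifP.
rewrite -[LHS]/(P (pairX @^-1` (A `*` B))).
rewrite (_ : pairX @^-1` (A `*` B) = X @^-1` mxrect C); last first.
  apply/seteqP; split => w /= => [[wA wB] i k|h].
    rewrite /C; case: (k =P j) => // ->; case: (i =P a) => [->//|_].
    by case: (i =P b) => [->//|].
  split => /=.
    by have := h a j; rewrite /C !eqxx.
  by have := h b j; rewrite /C !eqxx eq_sym (negbTE ab).
rewrite (gX.2 C mC) (@prode2 _ _ _ (fun _ _ => 1%E) a b j)//; last first.
  move=> i k; rewrite !xpair_eqE /C => /negbTE ia /negbTE ib.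
  move: ia ib; case: (k == j) => /=; rewrite ?andbT; last by rewrite normal_setT.
  by move=> -> ->; rewrite normal_setT.
rewrite big1 ?mul1e; last by move=> i _; rewrite big1.
by rewrite /C !eqxx (eq_sym b) (negbTE ab).
Qed.

(** The event is the intersection of a rectangle in the untouched entries with an event of the
    rotated pair; these are independent, and the pair keeps its law. *)
Lemma gmx_rot1 c s : c ^+ 2 + s ^+ 2 = 1 -> s != 0 ->
  gmx P (fun w => rotmx1 a b j c s (X w)).
Proof.
move=> cs s0; split=> [i k|B mB].
  under eq_fun do rewrite mxE.
  case: (k == j); last exact: gX.1.
  case: (i == a).
    by apply: measurable_funD; apply: measurable_funM => //; exact: gX.1.
  case: (i == b); last exact: gX.1.
  by apply: measurable_funD; apply: measurable_funM => //; exact: gX.1.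
pose C i k := if off i k then B i k else setT.
have mC i k : measurable (C i k) by rewrite /C; case: ifP.
pose G : set (MR * MR) :=
  [set z | B a j (c * z.1 + s * z.2) /\ B b j (- s * z.1 + c * z.2)].
pose F : set (mxT R p q) := [set M | G (M a j, M b j)].
have mG : measurable G.
  pose rot (z : MR * MR) : MR * MR := (c * z.1 + s * z.2, - s * z.1 + c * z.2).
  have mrot : measurable_fun setT rot.
    by apply: measurable_fun_pair; apply: measurable_funD; apply: measurable_funM.
  rewrite -[X in measurable X]setTI; apply: (mrot _ (B a j `*` B b j)) => //.
  exact: (@measurableX _ _ MR MR _ _ (mB a j) (mB b j)).
have mF : measurable F.
  have mp : measurable_fun setT (fun M : mxT R p q => (M a j, M b j) : MR * MR).
    by apply: measurable_fun_pair; exact: measurable_entry.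
  by rewrite -[X in measurable X]setTI; exact: mp.
rewrite (_ : _ @^-1` _ = X @^-1` (mxrect C `&` F)); last first.
  apply/seteqP; split => w /=.
    move=> h; split; last split.
    - move=> i k; have := h i k; rewrite mxE /C /off.
      by case: (k == j) => //=; case: (i == a) => //=; case: (i == b).
    - by have := h a j; rewrite mxE !eqxx.
    - by have := h b j; rewrite mxE !eqxx (eq_sym b) (negbTE ab).
  move=> [h1 [h2 h3]] i k; have := h1 i k; rewrite mxE /C /off.
  case: (k =P j) => //= ->; case: (i =P a) => //= [->//|_].
  by case: (i =P b) => //= ->.
apply: (etrans (gmx_indep gX (S := off) _ mF _ _)).
- exact: measurable_mxrect.
- move=> M N; split=> h i k; have := h i k; rewrite /C mxE; by case: (off i k).
- by move=> M N; rewrite /F /= !mxE /off !eqxx orbT.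
rewrite (@prode2 _ _ _ (fun i k => gam (C i k)) a b j)//; first last.
- by move=> i k ia ib; rewrite /C /off; move: ia ib; rewrite !xpair_eqE; case: (k == j); case: (i == a); case: (i == b).
- by rewrite /C /off !eqxx orbT normal_setT.
- by rewrite /C /off !eqxx normal_setT.
apply: congr2; first exact: gX.2.
by apply: (etrans (gmx_pair mG)); exact: (normal_prod_rot cs s0 (mB a j) (mB b j)).
Qed.

End Rot1.

Definition rotmx p (a b : 'I_p) (c s : R) : 'M[R]_p :=
  \matrix_(i, k)
    if i == a then c *+ (k == a) + s *+ (k == b)
    else if i == b then c *+ (k == b) - s *+ (k == a) else (i == k)%:R.

Lemma mul_rotmx p q (a b : 'I_p) (c s : R) (M : 'M[R]_(p, q)) i k : a != b ->
  (rotmx a b c s *m M) i k =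
    if i == a then c * M a k + s * M b k
    else if i == b then - s * M a k + c * M b k else M i k.
Proof.
move=> ab; rewrite mxE.
under eq_bigr do rewrite mxE.
case: (i == a).
  rewrite (bigD1 a)//= (bigD1 b)//= 1?eq_sym// !eqxx (eq_sym b) (negbTE ab) !addr0 !add0r big1 ?addr0//.
  by move=> l /andP[/negbTE-> /negbTE->]; rewrite addr0 mul0r.
case: (i == b).
  rewrite (bigD1 a)//= (bigD1 b)//= 1?eq_sym// !eqxx (eq_sym b) (negbTE ab) subr0 !add0r big1 ?addr0//.
  by move=> l /andP[/negbTE-> /negbTE->]; rewrite subr0 mul0r.
rewrite (bigD1 i)//= eqxx mul1r big1 ?addr0// => l.
by rewrite eq_sym => /negbTE ->; rewrite mul0r.
Qed.

Lemma gmx_rotmx d (T : measurableType d) (P : probability T R) p q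
    (X : T -> 'M[R]_(p, q)) (a b : 'I_p) (c s : R) :
  a != b -> c ^+ 2 + s ^+ 2 = 1 -> s != 0 -> gmx P X ->
  gmx P (fun w => rotmx a b c s *m X w).
Proof.
move=> ab cs s0 gX.
(* Hybrid matrix: the first [k] columns are rotated, and one more column is rotated at each step of
   the induction. *)
pose Y k w := \matrix_(i, l) if (l < k)%N then (rotmx a b c s *m X w) i l else X w i l.
have gY k : (k <= q)%N -> gmx P (Y k).
  elim: k => [|k IH] kq.
    rewrite (_ : Y 0%N = X)//; apply/funext => w; apply/matrixP => i l.
    by rewrite mxE ltn0.
  have := gmx_rot1 (IH (ltnW kq)) (Ordinal kq) ab cs s0.
  congr gmx; apply/funext => w; apply/matrixP => i l.
  have YE t i' l' : Y t w i' l' =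
      if (l' < t)%N then (rotmx a b c s *m X w) i' l' else X w i' l' by rewrite mxE.
  rewrite mxE !YE ltnn ltnS [in RHS]leq_eqVlt -val_eqE/=.
  have [lk|//] := eqVneq (l : nat) k.
  by rewrite (_ : l = Ordinal kq) ?ltnn ?mul_rotmx//; apply/val_inj.
have := gY q (leqnn q); congr gmx; apply/funext => w; apply/matrixP => i l.
by rewrite mxE ltn_ord.
Qed.

Definition signmx p (a : 'I_p) : 'M[R]_p :=
  \matrix_(i, k) ((-1) ^+ (i == a) *+ (i == k)).

Lemma mul_signmx p q (a : 'I_p) (M : 'M[R]_(p, q)) i k :
  (signmx a *m M) i k = if i == a then - M i k else M i k.
Proof.
rewrite mxE (bigD1 i)//= big1 ?addr0 => [|l li]; last first.
  by rewrite mxE (eq_sym i l) (negbTE li) mul0r.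
by rewrite mxE eqxx; case: (i == a); rewrite ?expr0 ?mul1r// expr1 mulN1r.
Qed.

(** Words in generators, so that both orthogonality and the invariance of the Gaussian law go by
    induction. The nonzero sine comes from the decomposition into shears, which divides by it. *)
Inductive givens p : 'M[R]_p -> Prop :=
| givens1 : givens 1%:M
| givens_rot a b c s U : a != b -> c ^+ 2 + s ^+ 2 = 1 -> s != 0 ->
    givens U -> givens (rotmx a b c s *m U)
| givens_sign a U : givens U -> givens (signmx a *m U).

Lemma gmx_givens d (T : measurableType d) (P : probability T R) p q
    (X : T -> 'M[R]_(p, q)) U : gmx P X -> givens U -> gmx P (fun w => U *m X w).
Proof.
move=> gX; elim=> {U} [|a b c s U ab cs s0 _ IH|a U _ IH].
- by move: gX; congr gmx; apply/funext => w; rewrite mul1mx.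
- by have := gmx_rotmx ab cs s0 IH; congr gmx; apply/funext => w; rewrite mulmxA.
- have := gmx_sign (fun i _ => i == a) IH; congr gmx; apply/funext => w.
  by apply/matrixP => i j; rewrite -mulmxA mul_signmx !mxE.
Qed.

Lemma rotmx_orthogonal p (a b : 'I_p) c s : a != b -> c ^+ 2 + s ^+ 2 = 1 ->
  (rotmx a b c s)^T *m rotmx a b c s = 1%:M.
Proof.
move=> ab cs.
suff h : rotmx a b c (- s) *m rotmx a b c s = 1%:M.
  rewrite -[RHS]h; congr (_ *m _); apply/matrixP => i k; rewrite !mxE.
  have ba : b == a = false by rewrite eq_sym (negbTE ab).
  have [->|/negbTE ia] := eqVneq i a; have [->|/negbTE ka] := eqVneq k a;
    rewrite ?(negbTE ab) ?eqxx ?ka ?ia ?mulr0n ?mulr1n ?addr0 ?add0r ?mulr0n ?addr0//.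
  - by case: (k == b).
  - by case: (i == b); rewrite ?opprK.
  - rewrite !subr0; have [kb|kb] := eqVneq k b; have [ib|ib] := eqVneq i b => //.
    + by rewrite -kb in ib; rewrite (negbTE ib).
    + by rewrite -ib in kb; rewrite (negbTE kb).
    + by rewrite eq_sym.
apply/matrixP => i k; rewrite mul_rotmx//.
have ba : b == a = false by rewrite eq_sym (negbTE ab).
rewrite !mxE !eqxx ba.
case: (i =P a) => [->|_].
  case: (k =P a) => [->|/eqP/negbTE ka]; rewrite ?(eq_sym a k) ?ka ?eqxx ?(negbTE ab) ?mulr0n ?mulr1n.
    by rewrite -cs; ring.
  by case: (k == b); ring.
case: (i =P b) => [->|_].
  case: (k =P b) => [->|/eqP/negbTE kb]; rewrite ?(eq_sym b k) ?kb ?eqxx ?ba ?mulr0n ?mulr1n.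
    by rewrite -cs; ring.
  by case: (k == a); ring.
by [].
Qed.

Lemma signmx_orthogonal p (a : 'I_p) : (signmx a)^T *m signmx a = 1%:M.
Proof.
have -> : (signmx a)^T = signmx a.
  by apply/matrixP => i k; rewrite !mxE (eq_sym k i); case: (i =P k) => [->|].
apply/matrixP => i k; rewrite mul_signmx !mxE.
by case: (i == a); rewrite ?expr0 ?expr1 ?mulNrn ?opprK.
Qed.

Lemma givens_orthogonal p (U : 'M[R]_p) : givens U -> U^T *m U = 1%:M.
Proof.
elim=> [|a b c s {}U ab cs s0 _ IH|a {}U _ IH]; first by rewrite trmx1 mul1mx.
  by rewrite trmx_mul mulmxA -(mulmxA U^T) rotmx_orthogonal// mulmx1.
by rewrite trmx_mul mulmxA -(mulmxA U^T) signmx_orthogonal// mulmx1.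
Qed.

Lemma givens_mul p (U V : 'M[R]_p) : givens U -> givens V -> givens (U *m V).
Proof.
move=> gU gV; elim: gU => [|a b c s {}U ab cs s0 _ IH|a {}U _ IH].
- by rewrite mul1mx.
- by rewrite -mulmxA; exact: givens_rot.
- by rewrite -mulmxA; exact: givens_sign.
Qed.

(** Cosine and sine are the entries of column [j] in rows [a] and [b], normalized; if the entry to
    be cleared is already zero the identity is taken, as the sine would vanish. The last clauses
    preserve the other rows and the zeros already produced. *)
Lemma givens_zero p q (M : 'M[R]_(p, q)) (a b : 'I_p) (j : 'I_q) : a != b ->
  exists U, [/\ givens U, (U *m M) b j = 0,
    forall i k, i != a -> i != b -> (U *m M) i k = M i k &
    forall k, M a k = 0 -> M b k = 0 -> (U *m M) a k = 0 /\ (U *m M) b k = 0].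
Proof.
move=> ab; have [Mb|Mb] := eqVneq (M b j) 0.
  exists 1%:M; rewrite mul1mx; split => //; exact: givens1.
pose r := Num.sqrt (M a j ^+ 2 + M b j ^+ 2).
have r2 : r ^+ 2 = M a j ^+ 2 + M b j ^+ 2.
  by rewrite sqr_sqrtr// addr_ge0// sqr_ge0.
have r0 : r != 0.
  by rewrite -sqrf_eq0 r2 gt_eqF// ltr_wpDl ?sqr_ge0// exprn_even_gt0.
exists (rotmx a b (M a j / r) (M b j / r) *m 1%:M).
have ba : b == a = false by rewrite eq_sym (negbTE ab).
split.
- apply: givens_rot => //; last exact: givens1.
    by rewrite !expr_div_n -mulrDl -r2 divff// sqrf_eq0.
  by rewrite mulf_neq0// invr_neq0.
- by rewrite mulmx1 mul_rotmx// eqxx ba; field.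
- by move=> i k /negbTE ia /negbTE ib; rewrite mulmx1 mul_rotmx// ia ib.
- by move=> k a0 b0; rewrite mulmx1 !mul_rotmx// !eqxx ba a0 b0 !mulr0 addr0.
Qed.

(** Row [a] is the pivot against each row below it in turn. The last two clauses protect the rows
    above the pivot and the columns cleared before. *)
Lemma givens_column p q (M : 'M[R]_(p, q)) (j : 'I_q) (a : 'I_p) :
  exists U, [/\ givens U, forall i : 'I_p, (a < i)%N -> (U *m M) i j = 0,
    forall (i : 'I_p) k, (i < a)%N -> (U *m M) i k = M i k &
    forall k, (forall i : 'I_p, (a <= i)%N -> M i k = 0) ->
      forall i : 'I_p, (a <= i)%N -> (U *m M) i k = 0].
Proof.
suff h t : (t <= p)%N -> exists U, [/\ givens U,
    forall i : 'I_p, (a < i)%N -> (i < t)%N -> (U *m M) i j = 0,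
    forall (i : 'I_p) k, (i < a)%N -> (U *m M) i k = M i k &
    forall k, (forall i : 'I_p, (a <= i)%N -> M i k = 0) ->
      forall i : 'I_p, (a <= i)%N -> (U *m M) i k = 0].
  have [U [gU h1 h2 h3]] := h p (leqnn p); exists U; split => // i ai.
  exact: h1.
elim: t => [|t IH] tp.
  by exists 1%:M; rewrite mul1mx; split => //; exact: givens1.
have [U [gU h1 h2 h3]] := IH (ltnW tp).
have [ta|at_] := leqP t a.
  exists U; split => // i ai it; apply: h1 => //.
  by move: (leq_ltn_trans ta ai); rewrite ltnNge -ltnS it.
have ab : a != Ordinal tp by rewrite -val_eqE/= ltn_eqF.
have [V [gV v1 v2 v3]] := givens_zero (U *m M) j ab.
exists (V *m U); rewrite -mulmxA; split.
- exact: givens_mul.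
- move=> i ai; rewrite ltnS leq_eqVlt => /orP[/eqP it|it].
    by rewrite (_ : i = Ordinal tp)//; exact/val_inj.
  rewrite v2 ?h1// -val_eqE/=; first by rewrite gtn_eqF.
  by rewrite ltn_eqF.
- move=> i k ia; rewrite v2 ?h2// -val_eqE/=; first by rewrite ltn_eqF.
  by rewrite ltn_eqF// (ltn_trans ia).
- move=> k k0 i ai.
  have [v4 v5] := v3 k (h3 k k0 a (leqnn a)) (h3 k k0 (Ordinal tp) (ltnW at_)).
  have [->//|ia] := eqVneq i a; have [->//|ib] := eqVneq i (Ordinal tp).
  by rewrite v2// h3.
Qed.

Lemma givens_triangular p q (M : 'M[R]_(p, q)) :
  exists2 U, givens U & forall (i : 'I_p) (j : 'I_q), (j < i)%N -> (U *m M) i j = 0.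
Proof.
suff h t : (t <= q)%N -> exists2 U, givens U &
    forall (i : 'I_p) (j : 'I_q), (j < t)%N -> (j < i)%N -> (U *m M) i j = 0.
  by have [U gU hU] := h q (leqnn q); exists U => // i j ji; exact: hU.
elim: t => [|t IH] tq; first by exists 1%:M; [exact: givens1|].
have [U gU hU] := IH (ltnW tq).
(* If t >= p, column [t] has no entry below the diagonal. *)
have [pt|tp] := leqP p t.
  exists U => // i j; rewrite ltnS leq_eqVlt => /orP[/eqP jt ji|]; last exact: hU.
  by have := leq_trans (ltn_ord i) pt; rewrite -jt ltnNge (ltnW ji).
have [V [gV v1 v2 v3]] := givens_column (U *m M) (Ordinal tq) (Ordinal tp).
exists (V *m U); first exact: givens_mul.
move=> i j; rewrite -mulmxA ltnS leq_eqVlt => /orP[/eqP jt ji|jt ji].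
  rewrite (_ : j = Ordinal tq); last exact/val_inj.
  by apply: v1 => /=; rewrite -jt.
have [it|ti] := ltnP i t; first by rewrite v2// hU.
by apply: v3 => // k /= tk; apply: hU => //; exact: leq_trans tk.
Qed.

End Givens.

(** * The mean of an inverse chi-square variable by Laplace transform *)

Section InverseChiSquare.
Variable R : realType.
Local Notation mu := (@lebesgue_measure R).
Local Notation MR := (measurableTypeR R).
Local Notation gam := (normal_prob (0 : R) 1).

(* The Laplace transform at [t] of the square of a standard normal variable. *)
Definition sqlaplace (t : R) : R := (Num.sqrt (1 + 2 * t))^-1.

Lemma sqlaplace_gt0 t : 0 < 1 + 2 * t -> 0 < sqlaplace t.
Proof. by move=> t0; rewrite invr_gt0 sqrtr_gt0. Qed.

Lemma measurable_expR_sq (t : R) : measurable_fun setT (fun x : MR => expR (- t * x ^+ 2)).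
Proof.
by apply: measurableT_comp => //; apply: measurable_funM.
Qed.

(** The tilted density is s times the centered normal density of standard deviation s = (1 + 2
    t)^(-1/2). Negative [t] are included for the sake of the second moment. *)
Lemma integral_normal_expR_sq (t : R) : 0 < 1 + 2 * t ->
  (\int[gam]_x (expR (- t * x ^+ 2))%:E = (sqlaplace t)%:E)%E.
Proof.
move=> t0; rewrite ge0_integral_normal//; last first.
  by apply/measurable_EFinP; exact: measurable_expR_sq.
pose s := sqlaplace t.
have s0 : 0 < s by exact: sqlaplace_gt0.
have s2 : s ^+ 2 = (1 + 2 * t)^-1 by rewrite exprVn sqr_sqrtr// ltW.
have t1 : 1 + 2 * t != 0 by rewrite gt_eqF.
under eq_integral => x _.
  rewrite -EFinM (_ : _ * _ = s * normal_pdf 0 s x); last first.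
    rewrite /normal_pdf oner_eq0 (gt_eqF s0).
    have -> : normal_peak s = s^-1 * normal_peak 1.
      rewrite /normal_peak expr1n mul1r -mulrnAr sqrtrM ?sqr_ge0// invfM.
      by rewrite sqrtr_sqr gtr0_norm.
    rewrite mulrCA -[in RHS]mulrA [in RHS]mulVKf ?gt_eqF//; congr (_ * _).
    rewrite /normal_fun -expRD; congr expR; rewrite !subr0 s2 expr1n.
    by field.
  rewrite EFinM; over.
rewrite ge0_integralZl_EFin//=.
- by rewrite integral_normal_pdf mule1.
- by move=> x _; rewrite lee_fin normal_pdf_ge0.
- by apply/measurable_EFinP; exact: measurable_normal_pdf.
- exact: ltW.
Qed.

Lemma is_derive_sqlaplace (t : R) : 0 <= t ->
  is_derive t 1 sqlaplace (- sqlaplace t ^+ 3).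
Proof.
move=> t0; have t1 : 0 < 1 + 2 * t by lra.
have s0 : Num.sqrt (1 + 2 * t) != 0 by rewrite gt_eqF// sqrtr_gt0.
have d1 : is_derive t 1 (fun x : R => 1 + 2 * x) 2.
  by apply: is_derive_eq; rewrite /GRing.scale /=; ring.
have d2 : is_derive t 1 (Num.sqrt \o (fun x : R => 1 + 2 * x))
    ((2 * Num.sqrt (1 + 2 * t))^-1 * 2).
  by apply: is_derive1_comp; exact: is_derive1_sqrt.
have d3 := is_deriveV (f := Num.sqrt \o (fun x : R => 1 + 2 * x)) s0 d2.
apply: (is_derive_eq (df := - sqlaplace t ^+ 3)) => //.
rewrite /sqlaplace /GRing.scale /=; by field.
Qed.

Lemma continuous_sqlaplace (t : R) : 0 <= t -> {for t, continuous sqlaplace}.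
Proof.
move=> t0; apply: differentiable_continuous; apply/derivable1_diffP.
by have [] := is_derive_sqlaplace t0.
Qed.

Lemma sqlaplace_cvg0 : sqlaplace x @[x --> +oo] --> (0 : R).
Proof.
apply/cvgrPdist_le => e e0; near=> x.
rewrite sub0r normrN gtr0_norm; last first.
  apply: sqlaplace_gt0.
  have : 0 <= x by near: x; exact: nbhs_pinfty_ge.
  lra.
have x0 : 0 < 1 + 2 * x.
  have : 0 <= x by near: x; exact: nbhs_pinfty_ge.
  lra.
rewrite /sqlaplace -[leRHS]invrK lef_pV2 ?posrE ?sqrtr_gt0 ?invr_gt0//.
rewrite -(ler_pXn2r (n := 2)) ?nnegrE ?sqrtr_ge0 ?invr_ge0 ?(ltW e0)//.
rewrite sqr_sqrtr ?(ltW x0)//.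
suff : e^-1 ^+ 2 <= x by move: x0; lra.
by near: x; apply: nbhs_pinfty_ge; rewrite num_real.
Unshelve. all: by end_near. Qed.

(** Since L' = - L^3 for the transform L, a primitive of L^(n+3) is - L^(n+1) / (n + 1), which
    vanishes at infinity. *)
Lemma integral_sqlaplace n :
  (\int[mu]_(t in `[0%R, +oo[) (sqlaplace t ^+ n.+3)%:E = (n.+1%:R^-1)%:E)%E.
Proof.
pose F t := - (sqlaplace t ^+ n.+1 / n.+1%:R).
have dF (t : R) : 0 <= t -> is_derive t 1 F (sqlaplace t ^+ n.+3).
  move=> t0; have d1 := is_derive_sqlaplace t0.
  have d2 := is_deriveN (is_deriveZ n.+1%:R^-1 (is_deriveX n.+1 d1)).
  have -> : F = - (n.+1%:R^-1 \*: sqlaplace ^+ n.+1).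
    by apply/funext => x; rewrite /F !fctE /GRing.scale /= mulrC.
  apply: (is_derive_eq d2).
  rewrite /GRing.scale /= mulrA mulrA mulVf ?pnatr_eq0// mul1r mulrN opprK -exprD.
  by rewrite addnC.
rewrite (@ge0_continuous_FTC2y R (fun t => sqlaplace t ^+ n.+3) F 0 0).
- rewrite /F /sqlaplace mulr0 addr0 sqrtr1 invr1 expr1n -EFinB.
  by rewrite opprK add0r mul1r.
- by move=> x x0; rewrite exprn_ge0// ltW// sqlaplace_gt0//; lra.
- apply: continuous_in_subspaceT => x; rewrite inE/= in_itv/= andbT => x0.
  have := @continuous_comp _ _ _ sqlaplace (fun y => y ^+ n.+3) x (continuous_sqlaplace x0).
  apply; exact: exprn_continuous.
- rewrite -oppr0 -[X in - X](mul0r n.+1%:R^-1).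
  apply: cvgN; apply: cvgMl.
  rewrite (_ : 0 = 0 ^+ n.+1 :> R); last by rewrite expr0n.
  exact: (continuous_cvg _ (@exprn_continuous R n.+1 0) sqlaplace_cvg0).
- by move=> x x0; have [] := dF x (ltW x0).
- apply: cvg_at_right_filter.
  apply: differentiable_continuous; apply/derivable1_diffP.
  by have [] := dF 0 (lexx _).
- move=> x; rewrite in_itv/= andbT => x0; rewrite derive1E.
  by have [_ ->] := dF x (ltW x0).
Qed.

Section Families.
Context d (T : measurableType d) (P : probability T R).

Lemma gmx_entry p q (X : T -> 'M[R]_(p, q)) i j (f : MR -> \bar R) : gmx P X ->
  measurable_fun setT f -> (forall x, 0 <= f x)%E ->
  (\int[P]_w f (X w i j) = \int[gam]_x f x)%E.
Proof.
move=> gX mf f0.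
have gx : gmx gam (fun x : MR => (\matrix_(k < 1, l < 1) x)).
  split=> [k l|B mB]; first by under eq_fun do rewrite mxE; exact: measurable_id.
  rewrite !big_ord1; congr (gam _); apply/seteqP; split => [x h|x Bx k l].
    by have := h ord0 ord0; rewrite mxE.
  by rewrite mxE !ord1.
have hI : injective (fun _ : 'I_1 * 'I_1 => (i, j)).
  by move=> [a b] [a' b'] _; rewrite !ord1.
have := @gmx_integral R _ _ _ _ _ _ _ _ _ (gmx_reindex hI gX) _ gx
  (fun M : mxT R 1 1 => f (M 0 0)).
under eq_integral do rewrite mxE/=.
move=> -> //; last by apply: (measurableT_comp mf); exact: measurable_entry.
by under eq_integral do rewrite mxE.
Qed.

(** Keeping the entry [a] and redrawing all the others separates its factor; the inner integral is
    the induction hypothesis. *)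
Lemma gmx_prod p (X : T -> 'cV[R]_p) (f : MR -> R) (r : seq 'I_p) : gmx P X ->
  measurable_fun setT f -> (forall x, 0 <= f x) -> uniq r ->
  (\int[P]_w (\prod_(i <- r) f (X w i 0%R))%:E =
   \prod_(i <- r) \int[gam]_x (f x)%:E)%E.
Proof.
move=> gX mf f0; elim: r => [|a r IH] /=.
  by move=> _; under eq_integral do rewrite big_nil; rewrite big_nil integral_cst// mul1e; exact: probability_setT.
move=> /andP[ar ur].
have mfe (i : 'I_p) : measurable_fun setT (fun M : mxT R p 1 => f (M i 0)).
  by apply: (measurableT_comp mf); exact: measurable_entry.
have mprod (s : seq 'I_p) : measurable_fun setT (fun M : mxT R p 1 => \prod_(i <- s) f (M i 0)).
  elim: s => [|b s IHs]; first by under eq_fun do rewrite big_nil; exact: measurable_cst.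
  by under eq_fun do rewrite big_cons; exact: measurable_funM.
have prod0 (s : seq 'I_p) M : 0 <= \prod_(i <- s) f (M i 0) by exact: prodr_ge0.
rewrite (@gmx_resample R _ _ _ _ _ _ gX (fun i _ => i == a)
  (fun M : mxT R p 1 => (\prod_(i <- a :: r) f (M i 0))%:E))//; last 2 first.
- exact/measurable_EFinP.
- by move=> M; rewrite lee_fin.
have mXP : measurable_fun setT (fun w => \prod_(i <- r) f (X w i 0)).
  exact: (measurableT_comp (mprod r) (gmx_measurable gX)).
transitivity (\int[P]_w ((f (X w a 0%R))%:E * \prod_(i <- r) \int[gam]_x (f x)%:E))%E.
  apply: eq_integral => w _; rewrite -IH// -ge0_integralZl_EFin//; last 2 first.
  - by move=> x _; rewrite lee_fin.
  - exact/measurable_EFinP.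
  apply: eq_integral => w' _; rewrite -EFinM big_cons mxE eqxx; congr (_ * _)%:E.
  apply: eq_big_seq => i ir; rewrite mxE ifN//.
  by apply: contraNN ar => /eqP <-.
rewrite ge0_integralZr//.
- by rewrite (gmx_entry _ _ (f := EFin \o f) gX)// ?big_cons//; exact/measurable_EFinP.
- apply/measurable_EFinP.
  exact: (measurableT_comp (mfe a) (gmx_measurable gX)).
- by move=> w _; rewrite lee_fin.
- by rewrite -IH// integral_ge0// => w _; rewrite lee_fin.
Qed.

Section LaplaceKernel.
Variables (p : nat) (X : T -> 'cV[R]_p) (A : {set 'I_p}).
Let D : set MR := [set` `[(0 : R), +oo[].

Let lap (z : T * MR) : \bar R :=
  ((expR (- z.2 * \sum_(i in A) X z.1 i 0%R ^+ 2))%:E * (\1_D z.2)%:E)%E.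

Let lap_ge0 z : (0 <= lap z)%E.
Proof. by rewrite mule_ge0// lee_fin ?expR_ge0. Qed.

Let integral_lap w :
  (\int[mu]_(t in `[0%R, +oo[) (expR (- t * \sum_(i in A) X w i 0%R ^+ 2))%:E =
   \int[mu]_t lap (w, t))%E.
Proof.
rewrite integral_mkcond; apply: eq_integral => t _.
by rewrite patchE /lap indicE /D /=; case: ifP; rewrite ?mule1 ?mule0.
Qed.

Let measurable_lap :
  (forall i, measurable_fun setT (fun w => X w i 0)) -> measurable_fun setT lap.
Proof.
move=> mX; apply: emeasurable_funM; last first.
  have mD : measurable_fun setT (\1_D : MR -> R).
    by apply: measurable_indic; exact: measurable_itv.
  by apply/measurable_EFinP; apply: (measurableT_comp mD).
apply/measurable_EFinP; apply: measurableT_comp => //.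
apply: measurable_funM; first by apply: measurableT_comp.
under eq_fun do rewrite -big_enum/=.
apply: measurable_sum => i; apply: measurable_funX.
exact: (measurableT_comp (mX i)).
Qed.

Lemma measurable_integral_expR_sq :
  (forall i, measurable_fun setT (fun w => X w i 0)) ->
  measurable_fun setT (fun w => \int[mu]_(t in `[0%R, +oo[)
    (expR (- t * \sum_(i in A) X w i 0%R ^+ 2))%:E)%E.
Proof.
move=> mX; under eq_fun do rewrite integral_lap.
exact: (@measurable_fun_fubini_tonelli_F _ _ _ _ _ mu _ (measurable_lap mX)).
Qed.

(** The inner integral stands for 1 / S with S chi-square of n + 3 degrees of freedom; it is
    infinite at S = 0, where the inverse in the field would be 0. After Tonelli the mean at fixed
    [t] is [sqlaplace t ^+ n.+3]. *)
Lemma gmx_inv_chi n : gmx P X -> #|A| = n.+3 ->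
  (\int[P]_w \int[mu]_(t in `[0%R, +oo[)
     (expR (- t * \sum_(i in A) X w i 0%R ^+ 2))%:E = (n.+1%:R^-1)%:E)%E.
Proof.
move=> gX cA; under eq_integral do rewrite integral_lap.
have ml := measurable_lap (fun i => gX.1 i 0).
have e := @fubini_tonelli _ _ _ _ R P mu _ ml lap_ge0.
apply: (etrans e); rewrite /fubini_G.
rewrite -integral_sqlaplace [RHS]integral_mkcond; apply: eq_integral => t _.
rewrite patchE.
case: ifPn => [|tD]; last first.
  by apply: integral0_eq => w _; rewrite /lap /= indicE (negbTE tD) mule0.
rewrite inE/= in_itv/= andbT => t0.
transitivity (\int[P]_w (\prod_(i <- enum A) expR (- t * X w i 0%R ^+ 2))%:E)%E.
  apply: eq_integral => w _; rewrite /lap /= indicE mem_set ?mule1; last first.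
    by rewrite /D /= in_itv/= andbT.
  by rewrite big_enum/= -expR_sum mulr_sumr.
rewrite (@gmx_prod _ _ (fun x => expR (- t * x ^+ 2)))//; last 2 first.
- exact: measurable_expR_sq.
- exact: enum_uniq.
rewrite integral_normal_expR_sq; last lra.
rewrite big_enum/=.
by rewrite prodEFin prodr_const cA.
Qed.

End LaplaceKernel.

End Families.
End InverseChiSquare.

(** * The squared Frobenius norm *)

Section Frobenius.
Variable R : realType.

(** The sum of the squares (A b_i - C a_i)^2 equals A (A B - C^2), where A and B are the sums of
    squares and C is the sum of products. *)
Lemma sum_cauchy_schwarz (I : finType) (a b : I -> R) :
  (\sum_i a i * b i) ^+ 2 <= (\sum_i a i ^+ 2) * (\sum_i b i ^+ 2).
Proof.
have expand (A C : R) : \sum_i (A * b i - C * a i) ^+ 2 =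
    A ^+ 2 * (\sum_i b i ^+ 2) - 2 * A * C * (\sum_i a i * b i) + C ^+ 2 * (\sum_i a i ^+ 2).
  rewrite !mulr_sumr -sumrB -big_split/=.
  by apply: eq_bigr => i _; ring.
set A := \sum_i a i ^+ 2; set B := \sum_i b i ^+ 2; set C := \sum_i _ * _.
have A0 : 0 <= A by apply: sumr_ge0 => i _; exact: sqr_ge0.
have : 0 <= \sum_i (A * b i - C * a i) ^+ 2 by apply: sumr_ge0 => i _; exact: sqr_ge0.
rewrite expand -/A -/B -/C (_ : _ + _ = A * (A * B - C ^+ 2)); last by ring.
have [A00 _|A0'] := eqVneq A 0.
  rewrite A00 mul0r /C big1 ?expr0n// => i _.
  have /eqP := A00; rewrite psumr_eq0; last by move=> k _; exact: sqr_ge0.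
  by move=> /allP/(_ i); rewrite mem_index_enum => /(_ isT)/=; rewrite sqrf_eq0 => /eqP->; rewrite mul0r.
by rewrite pmulr_rge0 ?subr_ge0// lt_def A0' A0.
Qed.

Definition frob2 p q (A : 'M[R]_(p, q)) : R := \sum_i \sum_j A i j ^+ 2.

Lemma frob2_ge0 p q (A : 'M[R]_(p, q)) : 0 <= frob2 A.
Proof. by apply: sumr_ge0 => i _; apply: sumr_ge0 => j _; exact: sqr_ge0. Qed.

Lemma frob2_tr p q (A : 'M[R]_(p, q)) : frob2 A^T = frob2 A.
Proof.
rewrite /frob2 exchange_big; apply: eq_bigr => i _; apply: eq_bigr => j _.
by rewrite mxE.
Qed.

Lemma frob2E p q (A : 'M[R]_(p, q)) : frob2 A = \tr (A^T *m A).
Proof.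
rewrite -frob2_tr /mxtrace; apply: eq_bigr => i _; rewrite mxE; apply: eq_bigr => j _.
by rewrite !mxE expr2.
Qed.

Lemma frob2_orthl p q r (U : 'M[R]_(p, q)) (A : 'M[R]_(q, r)) : U^T *m U = 1%:M ->
  frob2 (U *m A) = frob2 A.
Proof. by move=> hU; rewrite !frob2E trmx_mul mulmxA -(mulmxA A^T) hU mulmx1. Qed.

Lemma frob2_orthr p q r (A : 'M[R]_(p, q)) (V : 'M[R]_(r, q)) : V^T *m V = 1%:M ->
  frob2 (A *m V^T) = frob2 A.
Proof. by move=> hV; rewrite -frob2_tr trmx_mul trmxK frob2_orthl// frob2_tr. Qed.

Lemma frob2_mul p q r (A : 'M[R]_(p, q)) (B : 'M[R]_(q, r)) :
  frob2 (A *m B) <= frob2 A * frob2 B.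
Proof.
rewrite -(frob2_tr B) /frob2 mulr_suml ler_sum// => i _.
rewrite mulr_sumr ler_sum// => j _; rewrite mxE.
apply: le_trans (sum_cauchy_schwarz _ _) _.
by rewrite le_eqVlt; apply/orP; left; apply/eqP; congr (_ * _); apply: eq_bigr => k _; rewrite mxE.
Qed.

Lemma frob2Z p q (c : R) (A : 'M[R]_(p, q)) : frob2 (c *: A) = c ^+ 2 * frob2 A.
Proof.
rewrite /frob2 mulr_sumr; apply: eq_bigr => i _; rewrite mulr_sumr.
by apply: eq_bigr => j _; rewrite mxE exprMn.
Qed.

Lemma frob2_eq0 p q (A : 'M[R]_(p, q)) : (frob2 A == 0) = (A == 0).
Proof.
apply/eqP/eqP => [/eqP|->]; last first.
  by rewrite /frob2 big1// => i _; rewrite big1// => j _; rewrite mxE expr0n.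
rewrite psumr_eq0 => [/allP h|i _]; last by apply: sumr_ge0 => j _; exact: sqr_ge0.
apply/matrixP => i j; rewrite mxE.
have := h i (mem_index_enum i); rewrite /= psumr_eq0 => [/allP h'|k _]; last exact: sqr_ge0.
by have := h' j (mem_index_enum j); rewrite /= sqrf_eq0 => /eqP.
Qed.

Lemma frob2_gt0 p q (A : 'M[R]_(p, q)) : (0 < frob2 A) = (A != 0).
Proof. by rewrite lt_def frob2_ge0 andbT frob2_eq0. Qed.

Lemma quad_frob2 p q (M : 'M[R]_(q, p)) (x : 'cV[R]_p) :
  (x^T *m (M^T *m M) *m x) 0 0 = frob2 (M *m x).
Proof. by rewrite frob2E /mxtrace big_ord1 trmx_mul !mulmxA. Qed.

End Frobenius.

(** * Diagonal and trace of the regularized inverse Gram matrix *)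

Section RegularizedInverse.
Variable R : realType.

(** Used at e = 0, the Gram matrix of the sketch, and at e > 0, where it is always invertible and
    small [e] detects the singularity of the Gram matrix. *)
Definition reg_gram q p (e : R) (M : 'M[R]_(q, p)) : 'M[R]_p := M^T *m M + e%:M.

(* This is 0 if the regularized Gram matrix is singular. *)
Definition reg_inv q p (e : R) (M : 'M[R]_(q, p)) : 'M[R]_p :=
  (\det (reg_gram e M))^-1 *: \adj (reg_gram e M).

Lemma reg_inv_sing q p (e : R) (M : 'M[R]_(q, p)) :
  \det (reg_gram e M) = 0 -> reg_inv e M = 0.
Proof. by move=> h; rewrite /reg_inv h invr0 scale0r. Qed.

Lemma mul_reg_inv q p (e : R) (M : 'M[R]_(q, p)) :
  \det (reg_gram e M) != 0 -> reg_gram e M *m reg_inv e M = 1%:M.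
Proof.
by move=> h; rewrite -scalemxAr mul_mx_adj scale_scalar_mx mulVf.
Qed.

Lemma mul_reg_invl q p (e : R) (M : 'M[R]_(q, p)) :
  \det (reg_gram e M) != 0 -> reg_inv e M *m reg_gram e M = 1%:M.
Proof. by move=> h; apply: mulmx1C; exact: mul_reg_inv. Qed.

Lemma reg_gram_tr q p (e : R) (M : 'M[R]_(q, p)) : (reg_gram e M)^T = reg_gram e M.
Proof. by rewrite linearD/= trmx_mul trmxK tr_scalar_mx. Qed.

Lemma reg_inv_tr q p (e : R) (M : 'M[R]_(q, p)) : (reg_inv e M)^T = reg_inv e M.
Proof. by rewrite /reg_inv linearZ/= trmx_adj reg_gram_tr. Qed.

Lemma col_mulmx m n p (A : 'M[R]_(m, n)) (B : 'M[R]_(n, p)) j :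
  col j (A *m B) = A *m col j B.
Proof. by rewrite !colE mulmxA. Qed.

(** Column [j] of the inverse solves [reg_gram e M *m k = delta_mx j 0], so its entry [j] is the
    quadratic form of [reg_gram e M] at [k]. *)
Lemma reg_inv_diagE q p (e : R) (M : 'M[R]_(q, p)) j : \det (reg_gram e M) != 0 ->
  reg_inv e M j j = frob2 (M *m col j (reg_inv e M)) + e * frob2 (col j (reg_inv e M)).
Proof.
move=> h; set K := reg_inv e M; set k := col j K.
have -> : K j j = (k^T *m reg_gram e M *m k) 0 0.
  rewrite -mulmxA /k -col_mulmx mul_reg_inv// [RHS]mxE (bigD1 j)//= big1 ?addr0.
    by rewrite !mxE eqxx mulr1.
  by move=> l lj; rewrite !mxE (negbTE lj) mulr0.
rewrite /reg_gram mulmxDr mulmxDl mxE quad_frob2; congr (_ + _).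
rewrite mul_mx_scalar -scalemxAl mxE; congr (_ * _).
by rewrite frob2E /mxtrace big_ord1.
Qed.

Lemma reg_inv_diag_ge0 q p (e : R) (M : 'M[R]_(q, p)) j : 0 <= e ->
  0 <= reg_inv e M j j.
Proof.
move=> e0; have [h|h] := eqVneq (\det (reg_gram e M)) 0.
  by rewrite reg_inv_sing// mxE.
by rewrite reg_inv_diagE// addr_ge0 ?frob2_ge0// mulr_ge0// frob2_ge0.
Qed.

(* With [k] the column [j] of the inverse, [reg_inv_diagE] bounds the entry [j]
   of [k] from below by [|U M k|^2], and on the rows in [A] only column [j]
   contributes to [U M k]. *)
Lemma reg_inv_diag_bound q p (e : R) (M : 'M[R]_(q, p)) (U : 'M[R]_q) j
    (A : {set 'I_q}) : 0 <= e -> U^T *m U = 1%:M ->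
  (forall i l, i \in A -> l != j -> (U *m M) i l = 0) ->
  reg_inv e M j j * (\sum_(i in A) (U *m col j M) i 0 ^+ 2) <= 1.
Proof.
move=> e0 hU hA; set S := \sum_(i in A) _.
have S0 : 0 <= S by apply: sumr_ge0 => i _; exact: sqr_ge0.
have [h|h] := eqVneq (\det (reg_gram e M)) 0.
  by rewrite reg_inv_sing// mxE mul0r.
set y := reg_inv e M j j.
have y0 : 0 <= y by exact: reg_inv_diag_ge0.
have yS : y ^+ 2 * S <= y.
  rewrite {2}/y reg_inv_diagE// -[leLHS]addr0 lerD ?mulr_ge0 ?frob2_ge0//.
  set k := col j _; rewrite -(frob2_orthl (M *m k) hU) /frob2.
  rewrite mulr_sumr [leRHS](bigID (fun i => i \in A))/= -[leLHS]addr0 lerD//; last first.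
    by apply: sumr_ge0 => i _; apply: sumr_ge0 => l _; exact: sqr_ge0.
  apply: ler_sum => i iA; rewrite big_ord1 -exprMn.
  rewrite le_eqVlt; apply/orP; left; apply/eqP; congr (_ ^+ 2).
  rewrite mulmxA [RHS]mxE (bigD1 j)//= big1 ?addr0; last first.
    by move=> l lj; rewrite hA// mul0r.
  by rewrite mulrC -col_mulmx [col j (U *m M) i 0]mxE [k j 0]mxE.
have [y00|y0'] := eqVneq y 0; first by rewrite y00 mul0r ler01.
have yp : 0 < y by rewrite lt_def y0' y0.
by rewrite -(ler_pM2l yp) mulrA -expr2 mulr1.
Qed.

(** A kernel vector of the Gram matrix is an eigenvector of the inverse K for 1 / e, so |K|^2 >=
    e^(-2) in the Frobenius norm; and tr K >= e |K|^2 by the formula for the diagonal. *)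
Lemma reg_inv_trace_sing q p (e : R) (M : 'M[R]_(q, p)) : 0 < e ->
  \det (reg_gram 0 M) = 0 -> e^-1 <= \tr (reg_inv e M).
Proof.
move=> e0 h0.
have hquad (x : 'cV[R]_p) : (x^T *m reg_gram e M *m x) 0 0 = frob2 (M *m x) + e * frob2 x.
  rewrite /reg_gram mulmxDr mulmxDl mxE quad_frob2; congr (_ + _).
  rewrite mul_mx_scalar -scalemxAl mxE; congr (_ * _).
  by rewrite frob2E /mxtrace big_ord1.
have h : \det (reg_gram e M) != 0.
  apply/det0P => -[v v0 hv]; have := hquad v^T.
  rewrite trmxK hv mul0mx mxE => /esym/eqP.
  rewrite paddr_eq0 ?frob2_ge0 ?mulr_ge0 ?frob2_ge0 ?ltW//.
  by rewrite mulf_eq0 (gt_eqF e0) !frob2_eq0 trmx_eq0 (negbTE v0) andbF.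
set K := reg_inv e M.
have [v v0 hv] : exists2 v : 'rV[R]_p, v != 0 & v *m reg_gram 0 M = 0.
  by apply/det0P; rewrite h0.
have vK : v = e *: (v *m K).
  rewrite -[LHS]mulmx1 -(mul_reg_inv h) mulmxA -/K.
  have -> : reg_gram e M = reg_gram 0 M + e%:M by rewrite /reg_gram raddf0 addr0.
  by rewrite mulmxDr hv add0r mul_mx_scalar scalemxAl.
have fK : e ^- 2 <= frob2 K.
  have h1 : frob2 v <= e ^+ 2 * (frob2 v * frob2 K).
    by rewrite {1}vK frob2Z ler_pM2l ?exprn_gt0// frob2_mul.
  have v1 : 0 < frob2 v by rewrite frob2_gt0.
  rewrite -[leLHS]mul1r ler_pdivrMr ?exprn_gt0//.
  rewrite -(ler_pM2l v1) mulr1; apply: le_trans h1 _.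
  by rewrite le_eqVlt; apply/orP; left; apply/eqP; ring.
apply: (@le_trans _ _ (e * frob2 K)).
  rewrite -(ler_pM2l e0 (e ^- 2) _) in fK.
  apply: le_trans fK; rewrite le_eqVlt; apply/orP; left; apply/eqP; field.
  by rewrite gt_eqF.
rewrite -frob2_tr /frob2 mulr_sumr; apply: ler_sum => j _.
rewrite reg_inv_diagE// -/K -[leLHS]add0r lerD ?frob2_ge0// ler_pM2l//.
rewrite /frob2; apply: ler_sum => i _; rewrite big_ord1 !mxE.
by [].
Qed.

End RegularizedInverse.

(** * Measurability of matrix operations *)

Section MatrixOperations.
Variable R : realType.
Context d (T : measurableType d).

Lemma measurable_mxadd p q (X Y : T -> mxT R p q) :
  measurable_fun setT X -> measurable_fun setT Y ->
  measurable_fun setT (fun w => (X w + Y w : 'M[R]_(p, q)) : mxT R p q).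
Proof.
move=> mX mY; apply: measurable_mx => i j; under eq_fun do rewrite mxE.
by apply: measurable_funD; exact: measurable_mxE.
Qed.

Lemma measurable_mxopp p q (X : T -> mxT R p q) : measurable_fun setT X ->
  measurable_fun setT (fun w => (- X w : 'M[R]_(p, q)) : mxT R p q).
Proof.
move=> mX; apply: measurable_mx => i j; under eq_fun do rewrite mxE.
exact: (measurable_funN (measurable_mxE i j mX)).
Qed.

Lemma measurable_mulmx p q r (X : T -> mxT R p q) (Y : T -> mxT R q r) :
  measurable_fun setT X -> measurable_fun setT Y ->
  measurable_fun setT (fun w => (X w *m Y w : 'M[R]_(p, r)) : mxT R p r).
Proof.
move=> mX mY; apply: measurable_mx => i j; under eq_fun do rewrite mxE.
apply: measurable_sum => k.
by apply: measurable_funM; exact: measurable_mxE.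
Qed.

Lemma measurable_trmx p q (X : T -> mxT R p q) : measurable_fun setT X ->
  measurable_fun setT (fun w => ((X w)^T : 'M[R]_(q, p)) : mxT R q p).
Proof.
move=> mX; apply: measurable_mx => i j; under eq_fun do rewrite mxE.
exact: measurable_mxE.
Qed.

Lemma measurable_det p (X : T -> mxT R p p) : measurable_fun setT X ->
  measurable_fun setT (fun w => \det (X w : 'M[R]_p)).
Proof.
move=> mX; apply: measurable_sum => s; apply: measurable_funM => //.
apply: measurable_prod => i _; exact: measurable_mxE.
Qed.

Lemma measurable_adj p (X : T -> mxT R p p) : measurable_fun setT X ->
  measurable_fun setT (fun w => (\adj (X w : 'M[R]_p)) : mxT R p p).
Proof.
move=> mX; apply: measurable_mx => i j; under eq_fun do rewrite mxE.
apply: measurable_funM => //; apply: measurable_det.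
apply: measurable_mx => k l; under eq_fun do rewrite !mxE.
exact: measurable_mxE.
Qed.

Lemma measurable_frob2 p q (X : T -> mxT R p q) : measurable_fun setT X ->
  measurable_fun setT (fun w => frob2 (X w : 'M[R]_(p, q))).
Proof.
move=> mX; apply: measurable_sum => i; apply: measurable_sum => j.
by apply: measurable_funX; exact: measurable_mxE.
Qed.

Lemma measurable_reg_gram p q e (X : T -> mxT R q p) : measurable_fun setT X ->
  measurable_fun setT (fun w => reg_gram e (X w : 'M[R]_(q, p)) : mxT R p p).
Proof.
move=> mX; apply: measurable_mxadd; last exact: measurable_cst.
by apply: measurable_mulmx => //; exact: measurable_trmx.
Qed.

Lemma measurable_invr (f : T -> R) : measurable_fun setT f ->
  measurable_fun setT (fun w => (f w)^-1).
Proof.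
(* Writing 1 / x as x (x^2)^(-1) reduces to a real power of a nonnegative number; at x = 0 both
   sides are 0. *)
move=> mf; rewrite (_ : (fun _ => _) = (fun w => f w * (f w ^+ 2) `^ (-1))).
  apply: measurable_funM => //.
  have mf2 : measurable_fun setT (fun w => f w ^+ 2) by exact: measurable_funX.
  exact: (measurableT_comp (@measurable_powR R (-1)) mf2).
apply/funext => w; rewrite powR_inv1 ?sqr_ge0//.
have [->|f0] := eqVneq (f w) 0; first by rewrite invr0 mul0r.
by rewrite expr2 invfM mulVKf.
Qed.

Lemma measurable_reg_inv p q e (X : T -> mxT R q p) : measurable_fun setT X ->
  measurable_fun setT (fun w => reg_inv e (X w : 'M[R]_(q, p)) : mxT R p p).
Proof.
move=> mX; apply: measurable_mx => i j; under eq_fun do rewrite mxE.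
apply: measurable_funM.
  by apply: measurable_invr; apply: measurable_det; exact: measurable_reg_gram.
by apply: measurable_mxE; apply: measurable_adj; exact: measurable_reg_gram.
Qed.

End MatrixOperations.

(** * Second moments of linear images of a Gaussian matrix *)

Section SecondMoment.
Variable R : realType.
Local Notation MR := (measurableTypeR R).
Local Notation gam := (normal_prob (0 : R) 1).

(* From [1 + t x^2 <= exp (t x^2)], letting t tend to 0. *)
Lemma normal_second_moment : (\int[gam]_x (x ^+ 2)%:E <= 1)%E.
Proof.
have msq : measurable_fun setT (fun x : MR => (x ^+ 2)%:E).
  by apply/measurable_EFinP; exact: measurable_funX.
have sq0 (x : MR) : (0 <= (x ^+ 2)%:E)%E by rewrite lee_fin sqr_ge0.
have bound (t : R) : 0 < t -> 2 * t < 1 ->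
    (1 + t%:E * \int[gam]_x (x ^+ 2)%:E <= (sqlaplace (- t))%:E)%E.
  move=> t0 t1; rewrite -integral_normal_expR_sq; last lra.
  rewrite -ge0_integralZl_EFin//; last exact: ltW.
  rewrite -[X in (X + _ <= _)%E]normal_setT -[gam setT]mul1e -integral_cst//.
  rewrite -ge0_integralD//; last 2 first.
  - by move=> x _; rewrite -EFinM lee_fin mulr_ge0 ?sqr_ge0// ltW.
  - by under eq_fun do rewrite -EFinM; apply/measurable_EFinP; apply: measurable_funM => //; exact: measurable_funX.
  apply: ge0_le_integral => //.
  - by move=> x _; rewrite -EFinM -EFinD lee_fin addr_ge0// mulr_ge0 ?sqr_ge0// ltW.
  - apply: emeasurable_funD; first exact: measurable_cst.
    by under eq_fun do rewrite -EFinM; apply/measurable_EFinP; apply: measurable_funM => //; exact: measurable_funX.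
  - by apply/measurable_EFinP; exact: measurable_expR_sq.
  - by move=> x _; rewrite -EFinM -EFinD lee_fin opprK expR_ge1Dx.
have i0 : (0 <= \int[gam]_x (x ^+ 2)%:E)%E by exact: integral_ge0.
have t40 : 0 < 4^-1 :> R by rewrite invr_gt0.
have t41 : 2 * 4^-1 < 1 :> R by lra.
(* The bound at t = 1/4 excludes an infinite second moment. *)
have := bound _ t40 t41; move: bound i0.
case: (\int[gam]_x (x ^+ 2)%:E)%E => [E bound i0 _||//]; last first.
  by move=> _ _; rewrite gt0_muley ?lte_fin// addey// leye_eq.
rewrite lee_fin leNgt; apply/negP => E1.
rewrite lee_fin in i0.
(* As 4 t E = E - 1, the difference (1 + t E)^2 (1 - 2 t) - 1 equals t (E - 1 + t E^2 (1 - 2 t)),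
   which is positive if E > 1 and contradicts [h3]. *)
pose t := (E - 1) / (4 * E).
have E0 : 0 < E by lra.
have tE : t * (4 * E) = E - 1 by rewrite /t divfK// gt_eqF// mulr_gt0.
have t0 : 0 < t by rewrite divr_gt0 ?mulr_gt0// subr_gt0.
have t1 : 2 * t < 1 by nra.
have := bound t t0 t1; rewrite -EFinM -EFinD lee_fin => h.
have s2 : (sqlaplace (- t)) ^+ 2 * (1 - 2 * t) = 1.
  rewrite /sqlaplace exprVn sqr_sqrtr; last lra.
  by field; lra.
have s0 : 0 <= sqlaplace (- t) by rewrite ltW// sqlaplace_gt0; lra.
have h2 : (1 + t * E) ^+ 2 <= sqlaplace (- t) ^+ 2.
  by rewrite ler_pXn2r// nnegrE; nra.
have h3 : (1 + t * E) ^+ 2 * (1 - 2 * t) <= 1.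
  by rewrite -[leRHS]s2 ler_wpM2r//; lra.
nra.
Qed.

Context d (T : measurableType d) (P : probability T R).

(* Flipping the sign of a single entry removes its cross terms. *)
Lemma gmx_linear_moment p q (X : T -> 'M[R]_(p, q)) (c : 'I_p * 'I_q -> R)
    (r : seq ('I_p * 'I_q)) : gmx P X -> uniq r ->
  (\int[P]_w ((\sum_(x <- r) c x * X w x.1 x.2) ^+ 2)%:E <=
   (\sum_(x <- r) c x ^+ 2)%:E)%E.
Proof.
move=> gX; elim: r => [|a r IH].
  move=> _; rewrite integral0_eq ?big_nil// => w _.
  by rewrite big_nil expr0n.
move=> /= /andP[ar ur].
pose S (s : seq ('I_p * 'I_q)) (M : mxT R p q) := \sum_(x <- s) c x * M x.1 x.2.
have mS s : measurable_fun setT (S s).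
  by apply: measurable_sum => x; apply: measurable_funM => //; exact: measurable_entry.
pose f (M : mxT R p q) : \bar R := ((S (a :: r) M) ^+ 2)%:E.
have mf : measurable_fun setT f by apply/measurable_EFinP; apply: measurable_funX.
have f0 M : (0 <= f M)%E by rewrite lee_fin sqr_ge0.
pose Y w := \matrix_(i, j) if (i, j) == a then - X w i j else X w i j.
have gY : gmx P Y by exact: (gmx_sign (fun i j => (i, j) == a) gX).
have mX := gmx_measurable gX; have mY := gmx_measurable gY.
have mfX : measurable_fun setT (fun w => f (X w)) by exact: (measurableT_comp mf mX).
have mfY : measurable_fun setT (fun w => f (Y w)) by exact: (measurableT_comp mf mY).
have e1 : (\int[P]_w f (X w) = \int[P]_w f (Y w))%E by exact: gmx_integral.
have fXY w : (f (X w) + f (Y w) =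
    2%:E * ((c a ^+ 2 * X w a.1 a.2 ^+ 2)%:E + (S r (X w) ^+ 2)%:E))%E.
  rewrite /f /S !big_cons -!EFinD -EFinM; congr EFin.
  have -> : \sum_(x <- r) c x * Y w x.1 x.2 = \sum_(x <- r) c x * X w x.1 x.2.
    apply: eq_big_seq => x xr; rewrite mxE -surjective_pairing ifN//.
    by apply: contraNN ar => /eqP <-.
  by rewrite mxE -surjective_pairing eqxx; ring.
have mXa : measurable_fun setT (fun w => X w a.1 a.2) by exact: gX.1.
have mSr : measurable_fun setT (fun w => S r (X w)) by exact: (measurableT_comp (mS r) mX).
have e2 : (\int[P]_w f (X w) + \int[P]_w f (X w) =
   2%:E * (\int[P]_w (c a ^+ 2 * X w a.1 a.2 ^+ 2)%:E + \int[P]_w (S r (X w) ^+ 2)%:E))%E.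
  rewrite {2}e1 -ge0_integralD//.
  under eq_integral do rewrite fXY.
  rewrite ge0_integralZl_EFin//; last 2 first.
  - by move=> w _; rewrite -EFinD lee_fin addr_ge0 ?sqr_ge0// mulr_ge0 ?sqr_ge0.
  - apply/measurable_EFinP; apply: measurable_funD; last exact: measurable_funX.
    by apply: measurable_funM => //; exact: measurable_funX.
  rewrite ge0_integralD//.
  - by move=> w _; rewrite lee_fin mulr_ge0 ?sqr_ge0.
  - by apply/measurable_EFinP; apply: measurable_funM => //; exact: measurable_funX.
  - by move=> w _; rewrite lee_fin sqr_ge0.
  - by apply/measurable_EFinP; exact: measurable_funX.
have e3 : (\int[P]_w (c a ^+ 2 * X w a.1 a.2 ^+ 2)%:E <= (c a ^+ 2)%:E)%E.
  under eq_integral do rewrite EFinM.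
  rewrite ge0_integralZl_EFin ?sqr_ge0//; last 2 first.
  - by move=> w _; rewrite lee_fin sqr_ge0.
  - by apply/measurable_EFinP; exact: measurable_funX.
  rewrite (gmx_entry _ _ (f := fun x : MR => (x ^+ 2)%:E) gX); last 2 first.
  - by apply/measurable_EFinP; exact: measurable_funX.
  - by move=> x; rewrite lee_fin sqr_ge0.
  by rewrite -[leRHS]mule1 lee_wpmul2l ?lee_fin ?sqr_ge0// normal_second_moment.
have e4 : (\int[P]_w f (X w) + \int[P]_w f (X w) <=
   2%:E * (\sum_(x <- a :: r) c x ^+ 2)%:E)%E.
  by rewrite e2 lee_wpmul2l// big_cons EFinD leeD// IH.
have -> : (fun w => ((\sum_(x <- a :: r) c x * X w x.1 x.2) ^+ 2)%:E) = (fun w => f (X w)) by [].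
move: e4; rewrite -mule2n -mule_natl; rewrite lee_pmul2l//.
Qed.

(** Entry (i, j) of the product is the linear form in X with coefficients D_ik M_lj, whose squares
    add up to the product of the two squared norms. *)
Lemma gmx_sandwich_moment p q a b (X : T -> 'M[R]_(p, q)) (D : 'M[R]_(a, p))
    (M : 'M[R]_(q, b)) : gmx P X ->
  (\int[P]_w (frob2 (D *m X w *m M))%:E <= (frob2 D * frob2 M)%:E)%E.
Proof.
move=> gX; pose c i j (x : 'I_p * 'I_q) := D i x.1 * M x.2 j.
have E w i j : (D *m X w *m M) i j = \sum_(x <- enum {: 'I_p * 'I_q}) c i j x * X w x.1 x.2.
  rewrite big_enum/= mxE.
  transitivity (\sum_l \sum_k c i j (k, l) * X w k l).
    apply: eq_bigr => l _; rewrite mxE mulr_suml; apply: eq_bigr => k _.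
    by rewrite /c /=; ring.
  by rewrite exchange_big pair_big.
have mc i j : measurable_fun setT (fun w => ((D *m X w *m M) i j)).
  apply: (@measurable_mxE _ _ _ _ _ (fun w => D *m X w *m M : mxT R a b)).
  apply: measurable_mulmx; last exact: measurable_cst.
  apply: measurable_mulmx; first exact: measurable_cst.
  exact: (gmx_measurable gX).
rewrite /frob2; under eq_integral do rewrite -sumEFin.
rewrite ge0_integral_sum//; last 2 first.
- move=> i; apply/measurable_EFinP; apply: measurable_sum => j; exact: measurable_funX.
- by move=> i w _; rewrite lee_fin sumr_ge0// => j _; rewrite sqr_ge0.
rewrite mulr_suml -sumEFin; apply: lee_sum => i _.
under eq_integral do rewrite -sumEFin.
rewrite ge0_integral_sum//; last 2 first.
- by move=> j; apply/measurable_EFinP; exact: measurable_funX.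
- by move=> j w _; rewrite lee_fin sqr_ge0.
rewrite exchange_big/= mulr_sumr -sumEFin; apply: lee_sum => j _.
under eq_integral do rewrite E.
apply: (le_trans (gmx_linear_moment _ gX (enum_uniq _))).
rewrite lee_fin big_enum/= mulr_suml le_eqVlt; apply/orP; left; apply/eqP.
transitivity (\sum_k \sum_l c i j (k, l) ^+ 2); first by rewrite pair_big; apply: eq_bigr => -[].
apply: eq_bigr => k _; rewrite mulr_sumr; apply: eq_bigr => l _.
by rewrite /c exprMn.
Qed.

End SecondMoment.

(** * The mean inverse Gram matrix of a Gaussian matrix *)

Section InverseGram.
Variable R : realType.
Local Notation mu := (@lebesgue_measure R).
Local Notation MR := (measurableTypeR R).

(** The integral is 1 / S for S > 0, by the total mass of the exponential law of rate S, and
    infinite for S = 0. *)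
Lemma le_integral_expR (S y : R) : 0 <= S -> y * S <= 1 ->
  (y%:E <= \int[mu]_(t in `[0%R, +oo[) (expR (- t * S))%:E)%E.
Proof.
move=> S0 yS; have [->|Sn0] := eqVneq S 0.
  under eq_integral do rewrite mulr0 expR0.
  by rewrite integral_cst//= lebesgue_measure_itv/= ltry mul1e leey.
have Sp : 0 < S by rewrite lt_def Sn0.
have e : (\int[mu]_(t in `[0%R, +oo[) (S * expR (- S * t))%:E = 1)%E.
  rewrite integral_mkcond -[RHS](integral_exponential_pdf Sp).
  by apply: eq_integral => x _; rewrite /exponential_pdf !patchE; case: ifP.
rewrite -(@lee_pmul2l _ S%:E)// -ge0_integralZl_EFin//.
- under [leRHS]eq_integral do rewrite -EFinM mulNr mulrC -mulNr.
  under [leRHS]eq_integral => t _ do rewrite (mulrC (expR _)) mulNr (mulrC t) -mulNr.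
  by rewrite e -EFinM lee_fin mulrC.
- by apply/measurable_EFinP; apply: measurableT_comp => //; exact: measurable_funM.
Qed.

Context d (T : measurableType d) (P : probability T R).

Lemma gmx_col p q (X : T -> 'M[R]_(p, q)) j : gmx P X -> gmx P (fun w => col j (X w)).
Proof.
move=> gX.
have hI : injective (fun ik : 'I_p * 'I_1 => (ik.1, j)).
  by move=> [i k] [i' k'] /= [->]; rewrite !ord1.
have := gmx_reindex hI gX; congr gmx; apply/funext => w.
Qed.

Lemma card_ord_geq q k : #|[set i : 'I_q | (k <= i)%N]%SET| = (q - k)%N.
Proof.
rewrite -sum1_card -[RHS]muln1 -sum_nat_const_nat big_geq_mkord/=.
by apply: eq_bigl => i; rewrite inE.
Qed.

Lemma reg_inv_diag_mean q p n e (X : T -> 'M[R]_(q, p)) j : gmx P X ->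
  q = (p + n.+2)%N -> 0 <= e ->
  (\int[P]_w (reg_inv e (X w) j j)%:E <= (n.+1%:R^-1)%:E)%E.
Proof.
move=> gX qE e0.
pose f (M : mxT R q p) : \bar R := (reg_inv e (M : 'M[R]_(q, p)) j j)%:E.
have mf : measurable_fun setT f.
  apply/measurable_EFinP; apply: measurable_mxE.
  by apply: measurable_reg_inv; exact: measurable_id.
have f0 M : (0 <= f M)%E by rewrite lee_fin reg_inv_diag_ge0.
pose S (i : 'I_q) (k : 'I_p) := k != j.
rewrite (gmx_resample gX S mf f0) -[leRHS]mule1 -(probability_setT P) -integral_cst//.
apply: ge0_le_integral => //.
- by move=> w _; apply: integral_ge0.
- have mfm : measurable_fun setT (fun z : T * T => f (mixmx S (X z.1) (X z.2))).
    by apply: (measurableT_comp mf); exact: (gmx_measurable (gmx_mix gX gX S)).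
  exact: (@measurable_fun_fubini_tonelli_F _ _ _ _ _ P _ mfm).
move=> w _; have [U gU hU] := givens_triangular (col' j (X w)).
(* The other p - 1 columns, once triangular, vanish in the rows from p - 1 on; there are q - (p - 1)
   = n + 3 of these. *)
pose A := [set i : 'I_q | (p.-1 <= i)%N]%SET.
have cA : #|A| = n.+3.
  rewrite card_ord_geq qE -(ltn_predK (ltn_ord j)) addSn -addnS/=.
  by rewrite addKn.
have gZ : gmx P (fun w' => U *m col j (X w')) by exact/gmx_givens/gU/gmx_col.
rewrite -(gmx_inv_chi gZ cA).
apply: ge0_le_integral => //.
- apply: (measurableT_comp mf); apply: measurable_mx => i k.
  by under eq_fun do rewrite mxE; case: (S i k); [exact: measurable_cst|exact: gX.1].
- by apply: measurable_integral_expR_sq => i; exact: gZ.1.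
move=> w' _; apply: le_integral_expR; first by apply: sumr_ge0 => i _; exact: sqr_ge0.
have -> : col j (X w') = col j (mixmx S (X w) (X w')).
  by apply/matrixP => i k; rewrite !mxE /S eqxx.
apply: reg_inv_diag_bound => //; first exact: givens_orthogonal.
move=> i l iA lj; have [l' ll'] : exists l', l = lift j l'.
  by case: (unliftP j l) lj => [l' ->|->]; [exists l'|rewrite eqxx].
have := hU i l' _; rewrite inE in iA; move=> /(_ (leq_trans (ltn_ord l') iA)) <-.
rewrite !mxE; apply: eq_bigr => k _; rewrite !mxE ll' /S.
by rewrite eq_sym neq_lift.
Qed.

Section GramMean.
Variables (p q n : nat) (X : T -> 'M[R]_(q, p)).
Hypotheses (gX : gmx P X) (qE : q = (p + n.+2)%N).

Lemma measurable_reg_inv_trace e :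
  measurable_fun setT (fun w => \tr (reg_inv e (X w))).
Proof.
apply: measurable_sum => j.
apply: (@measurable_mxE _ _ _ _ _ (fun w => reg_inv e (X w) : mxT R p p)).
exact: (measurable_reg_inv e (gmx_measurable gX)).
Qed.

Lemma reg_inv_trace_ge0 e (M : 'M[R]_(q, p)) : 0 <= e -> 0 <= \tr (reg_inv e M).
Proof. by move=> e0; apply: sumr_ge0 => j _; exact: reg_inv_diag_ge0. Qed.

Lemma reg_inv_trace_mean e : 0 <= e ->
  (\int[P]_w (\tr (reg_inv e (X w)))%:E <= (p%:R / n.+1%:R)%:E)%E.
Proof.
move=> e0; rewrite /mxtrace; under eq_integral do rewrite -sumEFin.
rewrite ge0_integral_sum//; last 2 first.
- move=> j; apply/measurable_EFinP.
  apply: (@measurable_mxE _ _ _ _ _ (fun w => reg_inv e (X w) : mxT R p p)).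
  exact: (measurable_reg_inv e (gmx_measurable gX)).
- by move=> j w _; rewrite lee_fin reg_inv_diag_ge0.
rewrite (_ : p%:R / n.+1%:R = \sum_(j < p) n.+1%:R^-1 :> R); last first.
  by rewrite sumr_const card_ord mulr_natl.
by rewrite -sumEFin; apply: lee_sum => j _; exact: reg_inv_diag_mean.
Qed.

Let sing : set T := [set w | \det (reg_gram 0 (X w)) == 0].

Let measurable_singb : measurable_fun setT (fun w => \det (reg_gram 0 (X w)) == 0).
Proof.
apply: measurable_fun_eqr => //; apply: measurable_det.
exact: (measurable_reg_gram 0 (gmx_measurable gX)).
Qed.

Let measurable_sing : measurable sing.
Proof.
rewrite (_ : sing = (fun w => \det (reg_gram 0 (X w)) == 0) @^-1` [set true]).
  by rewrite -[A in measurable A]setTI; exact: measurable_singb.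
by apply/seteqP; split => w /=; rewrite /sing /=; case: eqP.
Qed.

(* On this event the trace of [reg_inv e] is at least [1 / e], while its mean is
   bounded independently of [e]. *)
Lemma gram_sing_null : P sing = 0%E.
Proof.
have bound e : 0 < e -> (P sing <= (e * (p%:R / n.+1%:R))%:E)%E.
  move=> e0; have := reg_inv_trace_mean (ltW e0).
  have h : (\int[P]_w ((e^-1)%:E * (\1_sing w)%:E) <=
      \int[P]_w (\tr (reg_inv e (X w)))%:E)%E.
    apply: ge0_le_integral => //.
    - by move=> w _; rewrite mule_ge0// lee_fin// invr_ge0 ltW.
    - by apply: emeasurable_funM => //; apply/measurable_EFinP; exact: measurable_indic.
    - by apply/measurable_EFinP; exact: measurable_reg_inv_trace.
    move=> w _; rewrite -EFinM lee_fin indicE.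
    case: (boolP (w \in sing)) => [|_]; last by rewrite mulr0 reg_inv_trace_ge0// ltW.
    by rewrite inE => /eqP h0; rewrite mulr1 reg_inv_trace_sing.
  move=> /(le_trans h); rewrite ge0_integralZl_EFin//; last 2 first.
  - by apply/measurable_EFinP; exact: measurable_indic.
  - by rewrite invr_ge0 ltW.
  rewrite integral_indic// setIT => h1.
  rewrite -(@lee_pmul2l _ (e^-1)%:E) ?lte_fin ?invr_gt0//.
  by rewrite -EFinM mulrA mulVf ?gt_eqF// mul1r.
apply/eqP; rewrite eq_le measure_ge0 andbT.
apply/lee_addgt0Pr => e e0; rewrite add0e.
have c0 : 0 <= p%:R / n.+1%:R :> R by rewrite divr_ge0.
have c1 : 0 < p%:R / n.+1%:R + 1 :> R by rewrite ltr_wpDl.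
(* The added 1 keeps the divisor positive even if p = 0. *)
apply: le_trans (bound (e / (p%:R / n.+1%:R + 1)) _) _; first by rewrite divr_gt0.
rewrite lee_fin -mulrA ler_piMr ?(ltW e0)// mulrC ler_pdivrMr// mul1r.
by rewrite lerDl.
Qed.

(** The integrand is at most its finite part plus +oo times the indicator of the singular event, and
    the latter integrates to 0. *)
Lemma gram_cost_mean (a b : R) : 0 <= a -> 0 <= b ->
  (\int[P]_w (if \det (reg_gram 0 (X w)) == 0%R then +oo
              else (a + b * \tr (reg_inv 0 (X w)))%:E) <=
   (a + b * (p%:R / n.+1%:R))%:E)%E.
Proof.
move=> a0 b0.
have mtr := measurable_reg_inv_trace 0.
pose f w : \bar R := (a + b * \tr (reg_inv 0 (X w)))%:E.
have mf : measurable_fun setT f.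
  by apply/measurable_EFinP; apply: measurable_funD => //; apply: measurable_funM.
have f0 w : (0 <= f w)%E by rewrite lee_fin addr_ge0// mulr_ge0// reg_inv_trace_ge0.
pose o w : \bar R := (+oo * (\1_sing w : R)%:E)%E.
have mi : measurable_fun setT (fun w => (\1_sing w : R)%:E).
  by apply/measurable_EFinP; exact: measurable_indic.
have mo : measurable_fun setT o by apply: emeasurable_funM.
have o0 w : (0 <= o w)%E by rewrite mule_ge0 ?leey// lee_fin.
apply: (@le_trans _ _ (\int[P]_w (o w + f w))%E).
  apply: ge0_le_integral => //.
  - move=> w _; case: ifP => _; first exact: leey.
    exact: (f0 w).
  - apply: measurable_fun_ifT => //.
  - exact: emeasurable_funD.
  move=> w _; rewrite /o indicE; case: ifPn => h.
    by rewrite mem_set// mule1 addye// gt_eqF// (lt_le_trans (ltNy0 R)).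
  rewrite memNset ?mule0 ?add0e//.
  exact/negP.
rewrite ge0_integralD//.
have -> : (\int[P]_w o w = 0)%E.
  rewrite /o ge0_integralZl//= integral_indic// setIT.
  by apply: (etrans (congr1 (mule +oo) gram_sing_null)); rewrite mule0.
rewrite add0e /f.
under eq_integral do rewrite EFinD EFinM.
rewrite ge0_integralD//; last 2 first.
- by move=> w _; rewrite mule_ge0// lee_fin reg_inv_trace_ge0.
- by apply: emeasurable_funM => //; apply/measurable_EFinP.
have -> : (\int[P]_w a%:E = a%:E)%E.
  rewrite integral_cst//.
  by apply: (etrans (congr1 (mule a%:E) (probability_setT P))); rewrite mule1.
rewrite [leRHS]EFinD leeD2l//.
rewrite ge0_integralZl_EFin//; last 2 first.
- by move=> w _; rewrite lee_fin reg_inv_trace_ge0.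
- by apply/measurable_EFinP.
by rewrite EFinM lee_wpmul2l// reg_inv_trace_mean.
Qed.

End GramMean.

End InverseGram.

(** * The mean error of a sketched projection onto a fixed frame *)

Section SketchedProjection.
Variable R : realType.

(** A triangular matrix with orthonormal columns is diagonal with signs, by induction on the rows.
    In the rotated coordinates the frame thus consists of the first [a] unit vectors up to sign. *)
Lemma givens_frame N a (Q : 'M[R]_(N, a)) : Q^T *m Q = 1%:M ->
  exists U, exists b : 'I_a -> bool, givens U /\
    forall i j, (U *m Q) i j = (-1) ^+ b j *+ (i == j :> nat).
Proof.
move=> hQ; have [U gU hU] := givens_triangular Q.
have hT : (U *m Q)^T *m (U *m Q) = 1%:M.
  by rewrite trmx_mul mulmxA -(mulmxA Q^T) givens_orthogonal// mulmx1.
move: hU hT; set F := U *m Q => hU hT.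
have key k : forall (i : 'I_N) (j : 'I_a), (i < k)%N -> (i < j)%N -> F i j = 0.
  elim: k => // k IH i j; rewrite ltnS leq_eqVlt => /orP[/eqP ik ij|]; last exact: IH.
  pose i' : 'I_a := Ordinal (ltn_trans ij (ltn_ord j)).
  have col_i (j' : 'I_a) : (i' <= j')%N -> (F^T *m F) i' j' = F i i' * F i j'.
    move=> ij'; rewrite mxE (bigD1 i)//= mxE big1 ?addr0// => l li; rewrite mxE.
    have [il|li'] := ltnP i l; first by rewrite hU// mul0r.
    rewrite (IH l i')//= ?mul0r// -?ik.
      by rewrite ltn_neqAle li' andbT.
    by rewrite ltn_neqAle li' andbT.
  have := col_i i' (leqnn _); have := col_i j (ltnW ij).
  rewrite hT !mxE eqxx (_ : i' == j = false); last by rewrite -val_eqE/= ltn_eqF.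
  move=> /esym/eqP; rewrite mulf_eq0 => /orP[/eqP->|/eqP->//].
  by rewrite mul0r => /eqP; rewrite oner_eq0.
have off (i : 'I_N) (j : 'I_a) : (i != j :> nat) -> F i j = 0.
  rewrite neq_ltn => /orP[ij|]; last exact: hU.
  exact: (key i.+1).
have aN (j : 'I_a) : (j < N)%N.
  rewrite ltnNge; apply/negP => Nj.
  have : (F^T *m F) j j = 0.
    rewrite mxE big1// => l _; rewrite mxE off ?mul0r//.
    by rewrite ltn_eqF// (leq_trans (ltn_ord l)).
  by rewrite hT mxE eqxx => /eqP; rewrite oner_eq0.
have diag (j : 'I_a) : F (Ordinal (aN j)) j ^+ 2 = 1.
  have : (F^T *m F) j j = 1 by rewrite hT mxE eqxx.
  rewrite mxE (bigD1 (Ordinal (aN j)))//= mxE big1 ?addr0 ?expr2// => l lj.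
  by rewrite mxE off ?mul0r//; rewrite -val_eqE in lj.
exists U, (fun j => F (Ordinal (aN j)) j < 0); split => // i j; rewrite -/F.
have [ij|ij] := eqVneq (i : nat) j; last by rewrite off.
have -> : i = Ordinal (aN j) by exact/val_inj.
have /eqP := diag j; rewrite sqrf_eq1 => /orP[/eqP->|/eqP->].
  by rewrite ltNge ler01/= mulr1n.
by rewrite ltrN10/= mulr1n.
Qed.

(* The value is infinite on the null event where [X^T Q] is rank deficient, so
   that this function bounds the error of every choice of pseudoinverse. *)
Definition sketch_cost c N l a (C : 'M[R]_(c, N)) (Q : 'M[R]_(N, a))
    (X : 'M[R]_(N, l)) : \bar R :=
  let G := X^T *m Q in
  if \det (reg_gram 0 G) == 0 then +oo%E
  else (frob2 (C - C *m X *m G *m reg_inv 0 G *m Q^T))%:E.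

Lemma sketch_cost_ge0 c N l a (C : 'M[R]_(c, N)) (Q : 'M[R]_(N, a)) (X : 'M[R]_(N, l)) :
  (0 <= sketch_cost C Q X)%E.
Proof. by rewrite /sketch_cost; case: ifP; rewrite ?leey// lee_fin frob2_ge0. Qed.

Lemma reg_gram0 q p (M : 'M[R]_(q, p)) : reg_gram 0 M = M^T *m M.
Proof. by rewrite /reg_gram raddf0 addr0. Qed.

Lemma frob2_frame c N a (D : 'M[R]_(c, N)) (B : 'M[R]_(c, a)) (Q : 'M[R]_(N, a)) :
  Q^T *m Q = 1%:M -> D *m Q = 0 -> frob2 (D - B *m Q^T) = frob2 D + frob2 B.
Proof.
move=> hQ hD; rewrite -[LHS]frob2_tr -(frob2_tr D) -(frob2_tr B) !frob2E !trmxK.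
have hD' : Q^T *m D^T = 0 by rewrite -trmx_mul hD trmx0.
rewrite linearB/= trmx_mul trmxK mulmxBl !mulmxBr -!mulmxA (mulmxA D Q) hD mul0mx subr0.
rewrite hD' mulmx0 sub0r opprK (mulmxA Q^T Q) hQ mul1mx.
by rewrite linearD.
Qed.

(** The reconstruction reproduces the component of [C] along [Q]. What remains is the residual [D]
    and a term of the form [B *m Q^T]; they are orthogonal, so the squared norms add. *)
Lemma sketch_costE c N l a (C : 'M[R]_(c, N)) (Q : 'M[R]_(N, a)) (X : 'M[R]_(N, l)) :
  Q^T *m Q = 1%:M -> let D := C - C *m Q *m Q^T in let G := X^T *m Q in
  sketch_cost C Q X = if \det (reg_gram 0 G) == 0 then +oo%E
    else (frob2 D + frob2 (D *m X *m (G *m reg_inv 0 G)))%:E.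
Proof.
move=> hQ D G; rewrite /sketch_cost -/G; case: ifPn => // h; congr EFin.
have hD : D *m Q = 0 by rewrite /D mulmxBl -!mulmxA hQ mulmx1 subrr.
rewrite -(frob2_frame _ hQ hD); congr frob2.
have gen (D0 : 'M[R]_(c, N)) (B : 'M[R]_(c, a)) (Z : 'M[R]_(N, N)) : Q^T *m Z = Q^T ->
    D0 + B *m Q^T - (D0 + B *m Q^T) *m Z = D0 - D0 *m Z.
  by move=> hZ; rewrite mulmxDl -(mulmxA B) hZ opprD addrACA subrr addr0.
have e : Q^T *m (X *m (G *m (reg_inv 0 G *m Q^T))) = Q^T.
  rewrite (mulmxA Q^T X) -[Q^T *m X]trmxK trmx_mul trmxK -/G.
  by rewrite (mulmxA G^T) (mulmxA (G^T *m G)) -reg_gram0 mul_reg_inv// mul1mx.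
have := gen D (C *m Q) _ e; rewrite {1 2}/D subrK.
by rewrite !mulmxA.
Qed.

Context d (T : measurableType d) (P : probability T R).

Lemma sketch_cost_mean c N L a n (C : 'M[R]_(c, N)) (Q : 'M[R]_(N, a))
    (X : T -> 'M[R]_(N, L)) : gmx P X -> Q^T *m Q = 1%:M -> L = (a + n.+2)%N ->
  (\int[P]_w sketch_cost C Q (X w) <=
   ((1 + a%:R / n.+1%:R) * frob2 (C - C *m Q *m Q^T))%:E)%E.
Proof.
move=> gX hQ LE; have [U [b [gU hU]]] := givens_frame hQ.
have oU := givens_orthogonal gU.
set D := C - C *m Q *m Q^T.
pose F := U *m Q.
pose D' := D *m U^T.
have UU : U *m U^T = 1%:M by exact: mulmx1C.
have D'F : D' *m F = 0.
  rewrite /D' /F mulmxA -(mulmxA D) oU mulmx1.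
  by rewrite /D mulmxBl -!mulmxA hQ mulmx1 subrr.
(* The columns of [F] are signed unit vectors, so [D' *m F = 0] kills the first [a] columns of
   [D']. *)
have D'0 i (k : 'I_N) : (k < a)%N -> D' i k = 0.
  move=> ka; have := congr1 (fun M : 'M[R]_(c, a) => M i (Ordinal ka)) D'F.
  rewrite mxE (bigD1 k)//= hU eqxx mulr1n big1 ?addr0 ?mxE => [/eqP|l lk].
    by rewrite mulf_eq0 signr_eq0 orbF => /eqP.
  by rewrite hU /= (negbTE (_ : (l != k :> nat))) ?mulr0n ?mulr0.
pose Y w := U *m X w.
have gY : gmx P Y by exact: gmx_givens.
pose G (M : 'M[R]_(N, L)) := M^T *m F.
pose W M := G M *m reg_inv 0 (G M).
pose f (M : mxT R N L) : \bar R := if \det (reg_gram 0 (G M)) == 0 then +oo%E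
    else (frob2 D + frob2 (D' *m M *m W M))%:E.
have fE w : sketch_cost C Q (X w) = f (Y w).
  rewrite (sketch_costE _ _ hQ) -/D /f.
  have GE : G (Y w) = (X w)^T *m Q.
    by rewrite /G /Y /F trmx_mul mulmxA -(mulmxA (X w)^T) oU mulmx1.
  have DE : D' *m Y w = D *m X w by rewrite /D' /Y mulmxA -(mulmxA D) oU mulmx1.
  by rewrite /W GE DE.
have mG : measurable_fun setT (fun M : mxT R N L => G M : mxT R _ _).
  apply: measurable_mulmx; last exact: measurable_cst.
  by apply: measurable_trmx; exact: measurable_id.
have mW : measurable_fun setT (fun M : mxT R N L => W M : mxT R _ _).
  by apply: measurable_mulmx => //; exact: measurable_reg_inv.
have mf : measurable_fun setT f.
  apply: measurable_fun_ifT => //.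
  - apply: measurable_fun_eqr => //; apply: measurable_det.
    exact: measurable_reg_gram.
  - apply/measurable_EFinP; apply: measurable_funD => //; apply: measurable_frob2.
    apply: measurable_mulmx => //; apply: measurable_mulmx; first exact: measurable_cst.
    exact: measurable_id.
have f0 M : (0 <= f M)%E.
  by rewrite /f; case: ifP; rewrite ?leey// lee_fin addr_ge0 ?frob2_ge0.
under eq_integral do rewrite fE.
(* The rows below index [a] determine [G], and only the remaining rows enter [D' *m M]: the former
   are frozen and the latter redrawn. *)
pose S (i : 'I_N) (k : 'I_L) := (i < a)%N.
have SG M M' : G (mixmx S M M') = G M.
  apply/matrixP => k j; rewrite [LHS]mxE [RHS]mxE; apply: eq_bigr => l _.
  rewrite [(mixmx S M M')^T k l]mxE [M^T k l]mxE [mixmx S M M' l k]mxE /S.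
  by case: ltnP => // al; rewrite hU gtn_eqF ?mulr0n ?mulr0// (leq_trans (ltn_ord j)).
have SD M M' : D' *m mixmx S M M' = D' *m M'.
  apply/matrixP => k j; rewrite [LHS]mxE [RHS]mxE; apply: eq_bigr => l _.
  rewrite [mixmx S M M' l j]mxE /S.
  by case: ltnP => // al; rewrite D'0// !mul0r.
rewrite (gmx_resample gY S mf f0).
(* [G (Y w)] is the transpose of the first [a] rows of [Y w], up to the signs [b] of its columns. *)
have gG : gmx P (fun w => G (Y w)).
  have aN (j : 'I_a) : (j < N)%N.
    rewrite ltnNge; apply/negP => Nj.
    have : (F^T *m F) j j = 0.
      rewrite mxE big1// => l _; rewrite mxE hU ltn_eqF ?mul0r// (leq_trans (ltn_ord l))//.
    rewrite /F trmx_mul mulmxA -(mulmxA Q^T) oU mulmx1 hQ mxE eqxx => /eqP.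
    by rewrite oner_eq0.
  pose h (ij : 'I_L * 'I_a) : 'I_N * 'I_L := (Ordinal (aN ij.2), ij.1).
  have hI : injective h.
    by move=> [i j] [i' j'] [] /= jj ->; congr pair; exact/val_inj.
  have := gmx_sign (fun _ j => b j) (gmx_reindex hI gY).
  congr gmx; apply/funext => w; apply/matrixP => i j.
  rewrite [LHS]mxE [X in - X]mxE [X in if _ then _ else X]mxE [RHS]mxE.
  rewrite (bigD1 (Ordinal (aN j)))//= big1 ?addr0 => [|l lj].
    by rewrite hU eqxx mulr1n; case: (b j); rewrite ?expr1 ?mulrN1 ?expr0 ?mulr1 !mxE.
  by rewrite hU /= (negbTE (_ : (l != j :> nat))) ?mulr0n ?mulr0.
have fD0 : 0 <= frob2 D by exact: frob2_ge0.
rewrite mulrDl mul1r (mulrC (_ / _)).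
apply: (le_trans _ (gram_cost_mean gG LE fD0 fD0)).
apply: ge0_le_integral => //.
- by move=> w _; apply: integral_ge0.
- have mfm : measurable_fun setT (fun z : T * T => f (mixmx S (Y z.1) (Y z.2))).
    by apply: (measurableT_comp mf); exact: (gmx_measurable (gmx_mix gY gY S)).
  exact: (@measurable_fun_fubini_tonelli_F _ _ _ _ _ P _ mfm).
- apply: measurable_fun_ifT => //.
  + apply: measurable_fun_eqr => //; apply: measurable_det.
    exact: (measurable_reg_gram 0 (gmx_measurable gG)).
  + apply/measurable_EFinP; apply: measurable_funD => //; apply: measurable_funM => //.
    exact: measurable_reg_inv_trace gG _.
move=> w _; rewrite /f; case: ifPn => [_|hdet]; first exact: leey.
have hW M' : W (mixmx S (Y w) M') = W (Y w) by rewrite /W SG.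
under eq_integral do rewrite SG hW SD (negbTE hdet) EFinD.
have mfr : measurable_fun setT (fun w' => (frob2 (D' *m Y w' *m W (Y w)))%:E).
  apply/measurable_EFinP; apply: measurable_frob2.
  apply: measurable_mulmx; last exact: measurable_cst.
  by apply: measurable_mulmx; [exact: measurable_cst|exact: (gmx_measurable gY)].
rewrite ge0_integralD//; last first.
  by move=> w' _; rewrite lee_fin frob2_ge0.
have -> : (\int[P]_w' (frob2 D)%:E = (frob2 D)%:E)%E.
  rewrite integral_cst//.
  by apply: (etrans (congr1 (mule (frob2 D)%:E) (probability_setT P))); rewrite mule1.
rewrite EFinD leeD2l//.
apply: (le_trans (gmx_sandwich_moment _ _ gY)).
rewrite lee_fin le_eqVlt; apply/orP; left; apply/eqP; congr (_ * _).
  by rewrite /D' frob2_orthr.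
(* With K the inverse of [G^T *m G], W^T W = K G^T G K = K, so the squared norm of W is the trace of
   K. *)
rewrite frob2E /W trmx_mul reg_inv_tr -mulmxA (mulmxA (G (Y w))^T) -reg_gram0.
by rewrite mul_reg_inv// mulmx1.
Qed.

End SketchedProjection.

(** * Existence of positive semidefinite square roots *)

Section SquareRoot.
Import sesquilinear spectral complex.

Lemma poly_interpolation (F : fieldType) (f : F -> F) (s : seq F) :
  exists p : {poly F}, forall x, x \in s -> p.[x] = f x.
Proof.
elim: s => [|a s [p hp]]; first by exists 0.
have [as_|as_] := boolP (a \in s).
  by exists p => x; rewrite inE => /orP[/eqP->|]; exact: hp.
pose q := \prod_(y <- s) ('X - y%:P).
have q0 x : x \in s -> q.[x] = 0.
  by move=> xs; apply/eqP; rewrite -/(root q x) root_prod_XsubC.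
have qa : q.[a] != 0 by rewrite -/(root q a) root_prod_XsubC.
exists (p + ((f a - p.[a]) / q.[a]) *: q) => x; rewrite inE hornerD hornerZ.
move=> /orP[/eqP->|xs]; first by rewrite divfK// addrC subrK.
by rewrite (q0 x xs) mulr0 addr0 hp.
Qed.

Variable R : realType.

Let C := (R[i])%C.
Let rc := real_complex R.

(** The complex spectral theorem gives real eigenvalues. Each is a root of the real characteristic
    polynomial, so it has a real eigenvector, on which the quadratic form gives its sign. *)
Lemma psd_diagonalizable p (M : 'M[R]_p) : psdmx M ->
  exists V : 'M[C]_p, exists d : 'rV[R]_p, [/\ V \in unitmx,
    forall j, 0 <= d 0 j &
    map_mx rc M = invmx V *m diag_mx (map_mx rc d) *m V].
Proof.
move=> [Msym Mpos].
set MC := map_mx rc M.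
have MCreal : MC \is a (mxOver Num.real).
  by apply/mxOverP => i j; rewrite mxE; apply/complex_realP; exists (M i j).
have MCsym : MC \is symmetricmx.
  by apply/is_hermitianmxP; rewrite expr0 scale1r map_mx_id// map_trmx Msym.
have MCh := realsym_hermsym MCsym MCreal.
have /orthomx_spectralP Mspec := hermitian_normalmx MCh.
have dreal := hermitian_spectral_diag_real MCh.
set V := spectralmx MC in Mspec; set D := spectral_diag MC in Mspec dreal.
have Vu : V \in unitmx by exact: spectral_unit.
pose d : 'rV[R]_p := \row_j Re (D 0 j).
have dD : map_mx rc d = D.
  apply/rowP => j; rewrite !mxE; apply: RRe_real.
  by move/mxOverP: dreal; apply.
exists V, d; split; [exact: Vu| |by rewrite dD].
move=> j.
have eigC : eigenvalue MC (rc (d 0 j)).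
  apply/eigenvalueP; exists (row j V); last first.
    apply/eqP => /(congr1 (mulmx^~ (invmx V))).
    rewrite -row_mul mulmxV// mul0mx => /rowP/(_ j); rewrite !mxE eqxx => /eqP.
    by rewrite oner_eq0.
  rewrite -row_mul Mspec !mulmxA mulmxV// mul1mx row_mul.
  have -> : row j (diag_mx D) = (rc (d 0 j)) *: delta_mx 0 j.
    apply/rowP => k; rewrite !mxE eqxx/=.
    have := congr1 (fun N : 'rV_p => N 0 j) dD; rewrite !mxE => ->.
    by rewrite (eq_sym k); case: eqP => [->|_]; rewrite ?mulr1n ?mulr0n ?mulr1 ?mulr0.
  by rewrite -scalemxAl -rowE.
have : eigenvalue M (d 0 j).
  move: eigC; rewrite !eigenvalue_root_char.
  by rewrite /MC -map_char_poly fmorph_root.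
move=> /eigenvalueP[v hv v0].
have vv : (v *m v^T) 0 0 = frob2 v^T.
  by rewrite frob2E /mxtrace big_ord1 trmxK.
have := Mpos v^T; rewrite trmxK hv -scalemxAl mxE vv.
by rewrite pmulr_lge0// frob2_gt0 trmx_eq0.
Qed.

(* A square root of [M] is [Q^2] with [Q] the real polynomial in [M] that
   takes the eigenvalues to their fourth roots. *)
Lemma psd_sqrt p (M : 'M[R]_p) : psdmx M ->
  exists B : 'M[R]_p, psdmx B /\ B *m B = M.
Proof.
case: p M => [|p] M hM.
  exists 0; split; last by apply/matrixP => -[].
  by split=> [|x]; [exact: trmx0|rewrite mulmx0 mul0mx mxE].
have [V [d [Vu d0 hd]]] := psd_diagonalizable hM.
(* With fourth roots, the square root [Q *m Q] equals [Q^T *m Q] and is visibly positive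
   semidefinite. *)
pose f (x : R) := Num.sqrt (Num.sqrt x).
have [q hq] := poly_interpolation f [seq d 0 j | j <- enum 'I_p.+1].
pose Q := horner_mx M q.
have Qsym : Q^T = Q.
  rewrite /Q; elim/poly_ind: (q) => [|r c IH]; first by rewrite rmorph0 trmx0.
  rewrite rmorphD rmorphM/= horner_mx_X horner_mx_C linearD/= tr_scalar_mx.
  rewrite -mulmxE trmx_mul IH hM.1; congr (_ + _).
  exact/comm_mx_horner.
have Q4 : Q *m Q *m (Q *m Q) = M.
  apply: (@map_mx_inj _ _ rc).
  have QC : map_mx rc Q = invmx V *m diag_mx (map_mx rc (map_mx f d)) *m V.
    rewrite /Q map_horner_mx hd (horner_mx_uconjC _ _ Vu) horner_mx_diag.
    apply: (congr1 (fun u => invmx V *m diag_mx u *m V)); apply/rowP => j; rewrite !mxE.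
    by rewrite horner_map/= hq// map_f// mem_enum.
  have mulD (u v : 'rV[C]_p.+1) :
      (invmx V *m diag_mx u *m V) *m (invmx V *m diag_mx v *m V) =
      invmx V *m diag_mx (\row_j (u 0 j * v 0 j)) *m V.
    rewrite -!mulmxA (mulmxA V) mulmxV// mul1mx (mulmxA (diag_mx u)).
    congr (_ *m (_ *m _)).
    by rewrite mulmx_diag.
  rewrite !map_mxM QC !mulD hd; apply: (congr1 (fun u => invmx V *m diag_mx u *m V)).
  apply/rowP => j; rewrite !mxE -!rmorphM/=; congr rc.
  by rewrite -!expr2 /f sqr_sqrtr ?sqrtr_ge0// sqr_sqrtr.
exists (Q *m Q); split => //; split=> [|x]; first by rewrite trmx_mul Qsym.
by rewrite -{1}Qsym quad_frob2 frob2_ge0.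
Qed.

End SquareRoot.

(** * Square roots and pseudoinverses as defined by choice *)

Section SqrtTheory.
Variable R : realType.

Lemma sqrtmxP p (M : 'M[R]_p) : psdmx M ->
  psdmx (sqrtmx M) /\ sqrtmx M *m sqrtmx M = M.
Proof.
move=> hM; have [B hB] := psd_sqrt hM.
exact: (@xgetPex _ 0 [set B | psdmx B /\ B *m B = M] (ex_intro _ B hB)).
Qed.

Lemma spd_psd p (M : 'M[R]_p) : spdmx M -> psdmx M.
Proof.
move=> [s h]; split => // x; have [->|x0] := eqVneq x 0; last exact/ltW/h.
by rewrite mulmx0 mxE.
Qed.

Lemma spd_unit p (M : 'M[R]_p) : spdmx M -> M \in unitmx.
Proof.
move=> [s h]; rewrite unitmxE unitfE; apply/det0P => -[v v0 hv].
have := h v^T; rewrite trmx_eq0 trmxK hv mul0mx mxE => /(_ v0).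
by rewrite ltxx.
Qed.

Lemma spd_inv p (M : 'M[R]_p) : spdmx M -> psdmx (invmx M).
Proof.
move=> hM; have Mu := spd_unit hM; have [Ms Mp] := spd_psd hM.
split=> [|x]; first by rewrite trmx_inv Ms.
have := Mp (invmx M *m x).
by rewrite trmx_mul trmx_inv Ms -!mulmxA (mulmxA M) mulmxV// mul1mx.
Qed.

Lemma sqrtmx_unit p (M : 'M[R]_p) : spdmx M -> sqrtmx M \in unitmx.
Proof.
move=> hM; have [_ e] := sqrtmxP (spd_psd hM).
have := spd_unit hM; rewrite -{1}e unitmx_mul => /andP[]//.
Qed.

Lemma spd_id_gram m n (B : 'M[R]_(m, n)) : spdmx (1%:M + B^T *m B).
Proof.
split=> [|x x0]; first by rewrite linearD/= trmx1 trmx_mul trmxK.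
rewrite mulmxDr mulmxDl mxE mulmx1 quad_frob2 ltr_pwDl ?frob2_ge0//.
have -> : (x^T *m x) 0 0 = frob2 x by rewrite frob2E /mxtrace big_ord1.
by rewrite frob2_gt0.
Qed.

(** The first and third Penrose conditions give B^T B X = B^T, which determines X when the Gram
    matrix is invertible. *)
Lemma moore_penrose_full q p (B : 'M[R]_(q, p)) : \det (reg_gram 0 B) != 0 ->
  moore_penrose B = reg_inv 0 B *m B^T.
Proof.
move=> h; have hK := mul_reg_inv h; have hK' := mul_reg_invl h.
have hG := reg_gram0 B.
have LB : reg_inv 0 B *m B^T *m B = 1%:M by rewrite -mulmxA -hG hK'.
have mpL : is_moore_penrose B (reg_inv 0 B *m B^T).
  split.
  - by rewrite -[LHS]mulmxA LB mulmx1.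
  - by rewrite LB mul1mx.
  - by rewrite !trmx_mul trmxK reg_inv_tr mulmxA.
  - by rewrite LB trmx1.
have [e1 _ e3 _] := @xgetPex _ 0 [set X | is_moore_penrose B X] (ex_intro _ _ mpL).
rewrite -/(moore_penrose B) in e1 e3; set X := moore_penrose B in e1 e3 *.
have e : B^T *m B *m X = B^T by rewrite -mulmxA -e3 -trmx_mul e1.
by rewrite -[LHS]mul1mx -hK' -mulmxA hG e.
Qed.

End SqrtTheory.

(** * Deterministic bounds on the solution error and the condition number *)

Section OperatorBounds.
Variable R : realType.

Lemma frob2_cV p (x : 'cV[R]_p) : frob2 x = \sum_i x i 0 ^+ 2.
Proof. by apply: eq_bigr => i _; rewrite big_ord1. Qed.

Lemma norm2E p (x : 'cV[R]_p) : norm2 x = Num.sqrt (frob2 x).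
Proof. by rewrite /norm2 frob2_cV. Qed.

Lemma norm2_ge0 p (x : 'cV[R]_p) : 0 <= norm2 x.
Proof. exact: sqrtr_ge0. Qed.

Lemma norm2_sq p (x : 'cV[R]_p) : norm2 x ^+ 2 = frob2 x.
Proof. by rewrite norm2E sqr_sqrtr// frob2_ge0. Qed.

Lemma norm2_0 p : norm2 (0 : 'cV[R]_p) = 0.
Proof. by apply/eqP; rewrite -sqrf_eq0 norm2_sq frob2_eq0. Qed.

Lemma norm2N p (x : 'cV[R]_p) : norm2 (- x) = norm2 x.
Proof. by rewrite !norm2E -scaleN1r frob2Z sqrrN expr1n mul1r. Qed.

Definition dotv p (x y : 'cV[R]_p) : R := (x^T *m y) 0 0.

Lemma dotvE p (x y : 'cV[R]_p) : dotv x y = \sum_i x i 0 * y i 0.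
Proof. by rewrite /dotv mxE; apply: eq_bigr => i _; rewrite mxE. Qed.

Lemma dotvv p (x : 'cV[R]_p) : dotv x x = norm2 x ^+ 2.
Proof. by rewrite norm2_sq frob2_cV dotvE; apply: eq_bigr => i _; rewrite expr2. Qed.

Lemma dotvC p (x y : 'cV[R]_p) : dotv x y = dotv y x.
Proof. by rewrite !dotvE; apply: eq_bigr => i _; rewrite mulrC. Qed.

Lemma dotv_mulmx p q (M : 'M[R]_(p, q)) x y : dotv x (M *m y) = dotv (M^T *m x) y.
Proof. by rewrite /dotv trmx_mul trmxK mulmxA. Qed.

Lemma dotvDr p (x y z : 'cV[R]_p) : dotv x (y + z) = dotv x y + dotv x z.
Proof. by rewrite /dotv mulmxDr mxE. Qed.

Lemma norm2_mulmx_sq p q (M : 'M[R]_(p, q)) x :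
  norm2 (M *m x) ^+ 2 = dotv x (M^T *m M *m x).
Proof. by rewrite -dotvv dotv_mulmx mulmxA dotvC. Qed.

Lemma dotv_id_gram p q (M : 'M[R]_(p, q)) x :
  dotv x ((1%:M + M^T *m M) *m x) = norm2 x ^+ 2 + norm2 (M *m x) ^+ 2.
Proof. by rewrite mulmxDl mul1mx dotvDr dotvv norm2_mulmx_sq. Qed.

Lemma dotv_le p (x y : 'cV[R]_p) : dotv x y <= norm2 x * norm2 y.
Proof.
have xy0 : 0 <= norm2 x * norm2 y by rewrite mulr_ge0 ?norm2_ge0.
apply: le_trans (ler_norm _) _.
rewrite -(ler_pXn2r (n := 2)) ?nnegrE// real_normK ?num_real//.
by rewrite exprMn !norm2_sq !frob2_cV dotvE sum_cauchy_schwarz.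
Qed.

Lemma ler_norm2D p (x y : 'cV[R]_p) : norm2 (x + y) <= norm2 x + norm2 y.
Proof.
rewrite -(ler_pXn2r (n := 2)) ?nnegrE ?addr_ge0 ?norm2_ge0//.
rewrite -dotvv dotvDr dotvC dotvDr (dotvC (x + y)) dotvDr (dotvC y x) !dotvv.
by have := dotv_le x y; lra.
Qed.

(** Bounds in this form add and compose without handling the supremum in [spectral_norm]. *)
Definition opbound p q (M : 'M[R]_(p, q)) (c : R) :=
  forall x, norm2 (M *m x) <= c * norm2 x.

Lemma opbound_frob p q (M : 'M[R]_(p, q)) : opbound M (Num.sqrt (frob2 M)).
Proof.
move=> x; rewrite -(ler_pXn2r (n := 2)) ?nnegrE ?mulr_ge0 ?sqrtr_ge0 ?norm2_ge0//.
by rewrite exprMn !norm2_sq sqr_sqrtr ?frob2_ge0// frob2_mul.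
Qed.

Lemma opbound_tr p q (M : 'M[R]_(p, q)) c : 0 <= c -> opbound M c -> opbound M^T c.
Proof.
move=> c0 h x; have [->|x0] := eqVneq (norm2 (M^T *m x)) 0.
  by rewrite mulr_ge0// norm2_ge0.
have xp : 0 < norm2 (M^T *m x) by rewrite lt_def x0 norm2_ge0.
rewrite -(ler_pM2l xp) -expr2 -dotvv dotv_mulmx trmxK dotvC.
apply: le_trans (dotv_le _ _) _; rewrite mulrCA mulrC mulrA.
by rewrite ler_wpM2r ?norm2_ge0// h.
Qed.

Lemma opboundM p q r (M : 'M[R]_(p, q)) (N : 'M[R]_(q, r)) c e : 0 <= c ->
  opbound M c -> opbound N e -> opbound (M *m N) (c * e).
Proof.
move=> c0 hM hN x; rewrite -mulmxA; apply: le_trans (hM _) _.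
by rewrite -mulrA ler_wpM2l.
Qed.

Lemma opboundD p q (M N : 'M[R]_(p, q)) c e :
  opbound M c -> opbound N e -> opbound (M + N) (c + e).
Proof.
move=> hM hN x; rewrite mulmxDl mulrDl; apply: le_trans (ler_norm2D _ _) _.
exact: lerD.
Qed.

Lemma spectral_norm_ge0 p q (M : 'M[R]_(p, q)) : 0 <= spectral_norm M.
Proof.
apply: ub_le_sup.
  exists (Num.sqrt (frob2 M)) => _ /= [x x1 <-].
  apply: le_trans (opbound_frob M x) _.
  by rewrite ler_piMr// sqrtr_ge0.
by exists 0; [rewrite /= norm2_0 ler01|rewrite mulmx0 norm2_0].
Qed.

Lemma spectral_norm_le p q (M : 'M[R]_(p, q)) c : 0 <= c -> opbound M c ->
  spectral_norm M <= c.
Proof.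
move=> c0 h; apply: ge_sup.
  by exists (norm2 (M *m 0)), 0 => //=; rewrite norm2_0 ler01.
move=> _ /= [x x1 <-]; apply: le_trans (h x) _.
by rewrite ler_piMr.
Qed.

(** The second argument is the squared error. *)
Definition gram_pert (s1 e2 : R) : R := 2 * s1 * Num.sqrt e2 + e2.

Lemma gram_pert_bound p q (A B : 'M[R]_(p, q)) s1 : 0 <= s1 -> opbound A s1 ->
  opbound (B^T *m B - A^T *m A) (gram_pert s1 (frob2 (A - B))).
Proof.
move=> s0 hA; pose E := B - A.
have eE : frob2 (A - B) = frob2 E by rewrite -opprB -scaleN1r frob2Z sqrrN expr1n mul1r.
have hE := opbound_frob E; have e0 := sqrtr_ge0 (frob2 E).
have -> : B^T *m B - A^T *m A = A^T *m E + E^T *m A + E^T *m E.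
  have -> : E^T = B^T - A^T by exact: linearB.
  rewrite /E !mulmxBl !mulmxBr.
  move: (A^T *m A) (A^T *m B) (B^T *m A) (B^T *m B) => a b c d.
  by apply/matrixP => i j; rewrite !mxE; ring.
have := opboundD (opboundD (opboundM s0 (opbound_tr s0 hA) hE)
  (opboundM e0 (opbound_tr e0 hE) hA)) (opboundM e0 (opbound_tr e0 hE) hE).
rewrite /gram_pert eE; congr opbound; rewrite -expr2 sqr_sqrtr ?frob2_ge0//.
by ring.
Qed.

Lemma gram_pert_ge0 s1 e2 : 0 <= s1 -> 0 <= e2 -> 0 <= gram_pert s1 e2.
Proof. by move=> s0 e0; rewrite addr_ge0// mulr_ge0 ?sqrtr_ge0// mulr_ge0. Qed.

(** The inverse of 1 + B^T B is thus a contraction: |x|^2 is at most the inner product of x with (1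
    + B^T B) x. *)
Lemma norm2_id_gram p q (B : 'M[R]_(q, p)) (x : 'cV[R]_p) :
  norm2 x <= norm2 ((1%:M + B^T *m B) *m x).
Proof.
have [->|x0] := eqVneq (norm2 x) 0; first exact: norm2_ge0.
have xp : 0 < norm2 x by rewrite lt_def x0 norm2_ge0.
rewrite -(ler_pM2l xp); apply: le_trans (dotv_le _ _).
by rewrite dotv_id_gram expr2 lerDl sqr_ge0.
Qed.

(** Both norms are roots of the quadratic form of [invmx G], so the two matrix roots need not be
    identified. *)
Lemma normM_inv p (G : 'M[R]_p) (x : 'cV[R]_p) : spdmx G ->
  normM (invmx G) x = norm2 (invmx (sqrtmx G) *m x).
Proof.
move=> hG; have [[S1 _] S2] := sqrtmxP (spd_psd hG); have [[T1 _] T2] := sqrtmxP (spd_inv hG).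
have Su := sqrtmx_unit hG.
rewrite /normM !norm2E -!quad_frob2 T1 T2 trmx_inv S1; congr Num.sqrt.
congr ((_ *m _ *m _) 0 0).
apply: (can_inj (mulKmx (spd_unit hG))); rewrite mulmxV ?spd_unit//.
by rewrite -{1}S2 mulmxA mulmxK// mulmxV.
Qed.

Section Pointwise.
Variables (m n : nat) (A B : 'M[R]_(m, n)) (s1 : R).
Hypotheses (s0 : 0 <= s1) (hA : opbound A s1).
Let D := gram_pert s1 (frob2 (A - B)).
Let D0 : 0 <= D. Proof. by rewrite gram_pert_ge0// frob2_ge0. Qed.

(** For S = Gamma^(-1/2), equating the two systems gives (1 + B^T B) S (x - y) = (B^T B - A^T A) S
    x. *)
Lemma solution_error (Gamma : 'M[R]_n) (g x y : 'cV[R]_n) : spdmx Gamma ->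
  gn_hessian Gamma (A^T *m A) *m x = - g ->
  gn_hessian Gamma (B^T *m B) *m y = - g ->
  normM (invmx Gamma) (x - y) / normM (invmx Gamma) x <= D.
Proof.
move=> hG hx hy; rewrite !normM_inv//; set S := invmx _.
have Su := sqrtmx_unit hG.
have eq1 : (1%:M + A^T *m A) *m (S *m x) = (1%:M + B^T *m B) *m (S *m y).
  apply: (can_inj (mulKmx (_ : S \in unitmx))); first by rewrite unitmx_inv.
  by rewrite !mulmxA; move: hx hy; rewrite /gn_hessian -/S => -> ->.
have key : norm2 (S *m (x - y)) <= D * norm2 (S *m x).
  apply: le_trans (norm2_id_gram B _) _.
  have -> : (1%:M + B^T *m B) *m (S *m (x - y)) = (B^T *m B - A^T *m A) *m (S *m x).
    rewrite mulmxBr mulmxBr -eq1 -mulmxBl; congr (_ *m _).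
    by rewrite opprD addrACA subrr add0r.
  exact: gram_pert_bound.
have [->|x0] := eqVneq (norm2 (S *m x)) 0; first by rewrite invr0 mulr0.
by rewrite ler_pdivrMr// lt_def x0 norm2_ge0.
Qed.

(** With W = (1 + B^T B)^(-1/2) and M = N^T N, |x|^2 = |W x|^2 + |B W x|^2 and |N x|^2 = |W x|^2 +
    |A W x|^2. They differ by at most D |W x|^2, so each is at most 1 + D times the other; M and its
    inverse are then bounded by 1 + D. *)
Lemma sqrt_kappa_precond :
  Num.sqrt (kappa2 (precond (A^T *m A) (B^T *m B))) <= 1 + D.
Proof.
have hI := spd_id_gram B.
have [[T1 _] T2] := sqrtmxP (spd_psd hI).
have Tu := sqrtmx_unit hI.
rewrite /precond; set T := sqrtmx _ in T1 T2 Tu *; set W := invmx T.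
have W1 : W^T = W by rewrite /W trmx_inv T1.
set M := W *m _ *m W.
have D1 : 0 <= 1 + D by rewrite addr_ge0.
pose C := col_mx 1%:M A.
have C1 : 1%:M + A^T *m A = C^T *m C.
  by rewrite tr_col_mx mul_row_col trmx1 mul1mx.
pose N := C *m W.
have MN : M = N^T *m N by rewrite /M /N C1 trmx_mul W1 !mulmxA.
have nx (x : 'cV[R]_n) : norm2 x ^+ 2 = norm2 (W *m x) ^+ 2 + norm2 (B *m (W *m x)) ^+ 2.
  by rewrite -{1}(mulKVmx Tu x) (norm2_mulmx_sq T) T1 T2 dotv_id_gram.
have nN (x : 'cV[R]_n) : norm2 (N *m x) ^+ 2 = norm2 (W *m x) ^+ 2 + norm2 (A *m (W *m x)) ^+ 2.
  by rewrite -dotv_id_gram C1 -(norm2_mulmx_sq C) mulmxA.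
have nAB (y : 'cV[R]_n) : norm2 (B *m y) ^+ 2 - norm2 (A *m y) ^+ 2 =
    dotv y ((B^T *m B - A^T *m A) *m y).
  by rewrite !norm2_mulmx_sq /dotv mulmxBl mulmxBr [RHS]mxE [X in _ = _ + X]mxE.
have gb := gram_pert_bound B s0 hA.
have le1 (y : 'cV[R]_n) : norm2 (B *m y) ^+ 2 - norm2 (A *m y) ^+ 2 <= D * norm2 y ^+ 2.
  rewrite nAB; apply: le_trans (dotv_le _ _) _.
  by rewrite expr2 mulrCA ler_wpM2l ?norm2_ge0// gb.
have le2 (y : 'cV[R]_n) : norm2 (A *m y) ^+ 2 - norm2 (B *m y) ^+ 2 <= D * norm2 y ^+ 2.
  rewrite -opprB nAB.
  have -> : - dotv y ((B^T *m B - A^T *m A) *m y) = dotv (- y) ((B^T *m B - A^T *m A) *m y).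
    by rewrite /dotv linearN/= mulNmx [RHS]mxE.
  apply: le_trans (dotv_le _ _) _.
  by rewrite norm2N expr2 mulrCA ler_wpM2l ?norm2_ge0// gb.
have bN : opbound N (Num.sqrt (1 + D)).
  move=> x; rewrite -(ler_pXn2r (n := 2)) ?nnegrE ?mulr_ge0 ?sqrtr_ge0 ?norm2_ge0//.
  rewrite exprMn (sqr_sqrtr D1) nN (nx x) mulrDl mul1r.
  have := le2 (W *m x); have := mulr_ge0 D0 (sqr_ge0 (norm2 (B *m (W *m x)))).
  by rewrite mulrDr; lra.
have bM : opbound M (1 + D).
  have := opboundM (sqrtr_ge0 _) (opbound_tr (sqrtr_ge0 _) bN) bN.
  by rewrite -expr2 (sqr_sqrtr D1) -MN.
have lower (x : 'cV[R]_n) : norm2 x <= (1 + D) * norm2 (M *m x).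
  have [->|x0] := eqVneq (norm2 x) 0; first by rewrite mulr_ge0 ?norm2_ge0.
  have xp : 0 < norm2 x by rewrite lt_def x0 norm2_ge0.
  rewrite -(ler_pM2l xp) -expr2 mulrCA.
  apply: (@le_trans _ _ ((1 + D) * norm2 (N *m x) ^+ 2)).
    rewrite nN (nx x) mulrDl mul1r.
    have := le1 (W *m x); have := mulr_ge0 D0 (sqr_ge0 (norm2 (A *m (W *m x)))).
    by rewrite mulrDr; lra.
  rewrite ler_wpM2l// MN (norm2_mulmx_sq N).
  exact: dotv_le.
have Mu : M \in unitmx.
  rewrite -unitmx_tr unitmxE unitfE; apply/det0P => -[v v0 hv].
  have := lower v^T; rewrite -[M]trmxK -trmx_mul hv trmx0 norm2_0 mulr0.
  rewrite leNgt => /negP; apply.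
  by rewrite lt_def norm2_ge0 andbT -sqrf_eq0 norm2_sq frob2_eq0 trmx_eq0.
have bMi : opbound (invmx M) (1 + D).
  by move=> x; have := lower (invmx M *m x); rewrite mulKVmx.
rewrite -[leRHS]ger0_norm// -sqrtr_sqr ler_wsqrtr// /kappa2 expr2.
by apply: ler_pM; rewrite ?spectral_norm_ge0//; exact: spectral_norm_le.
Qed.

End Pointwise.

End OperatorBounds.

(** * Expectations by domination, and integration over independent pairs *)

Section LowerIntegral.
Context d (T : measurableType d) (R : realType) (P : probability T R).

(* The expectation of a nonnegative function is a supremum over the simple
   functions below it, so that no measurability of [f] is needed here. *)
Lemma le_expectation_dominated (f : T -> R) (g : T -> \bar R) :
  (forall w, 0 <= f w) -> (forall w, (f w)%:E <= g w)%E ->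
  ('E_P[f] <= \int[P]_w g w)%E.
Proof.
move=> f0 fg; rewrite unlock ge0_integralTE//.
rewrite ge0_integralTE; last first.
  by move=> w; apply: le_trans (fg w); rewrite lee_fin.
apply: ereal_sup_le => _ [h hf <-]; exists h => // w.
exact: le_trans (hf w) (fg w).
Qed.

(** By independence the law of the pair is the product of the laws, and Tonelli applies. *)
Lemma indep_integral p q p' q' (X : T -> 'M[R]_(p, q)) (Y : T -> 'M[R]_(p', q'))
    (f : mxT R p q * mxT R p' q' -> \bar R) :
  measurable_fun setT (X : T -> mxT R p q) ->
  measurable_fun setT (Y : T -> mxT R p' q') ->
  independent_mx P X Y -> measurable_fun setT f -> (forall z, 0 <= f z)%E ->
  (\int[P]_w f (X w, Y w) = \int[P]_w \int[P]_w' f (X w, Y w'))%E.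
Proof.
move=> mX mY iXY mf f0.
pose FX : {mfun T >-> mxT R p q} := HB.pack (X : T -> mxT R p q)
  (isMeasurableFun.Build _ _ _ _ _ mX).
pose FY : {mfun T >-> mxT R p' q'} := HB.pack (Y : T -> mxT R p' q')
  (isMeasurableFun.Build _ _ _ _ _ mY).
have mXY : measurable_fun setT (fun w => (X w, Y w) : mxT R p q * mxT R p' q').
  exact: measurable_fun_pair.
pose FXY : {mfun T >-> (mxT R p q * mxT R p' q')%type} := HB.pack
  (fun w => (X w, Y w) : mxT R p q * mxT R p' q')
  (isMeasurableFun.Build _ _ _ _ _ mXY).
have e z : measurable z -> (distribution P FX \x distribution P FY)%E z = pushforward P FXY z.
  by apply: product_measure_unique => E F mE mF; exact: iXY.
transitivity (\int[pushforward P FXY]_z f z)%E.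
  by rewrite [RHS](ge0_integral_pushforward mXY).
transitivity (\int[distribution P FX \x distribution P FY]_z f z)%E.
  by apply: eq_measure_integral => E mE _; apply/esym/e.
rewrite fubini_tonelli1//.
rewrite ge0_integral_distribution//.
- apply: eq_integral => w _.
  have mfw : measurable_fun setT (fun N : mxT R p' q' => f (X w, N)).
    apply: (measurableT_comp mf).
    by apply: measurable_fun_pair; [exact: measurable_cst|exact: measurable_id].
  exact: (ge0_integral_distribution FY mfw (fun N => f0 (X w, N))).
- exact: measurable_fun_fubini_tonelli_F.
- by move=> M; exact: integral_ge0.
Qed.

End LowerIntegral.

(** * Singular values, the tail sum and the forms of Theta *)

Section SingularValueTail.
Variable R : realType.

Lemma ler_sum_inj (I J : finType) (h : I -> J) (f : J -> R) : injective h ->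
  (forall j, 0 <= f j) -> \sum_i f (h i) <= \sum_j f j.
Proof.
move=> hI f0; rewrite [leRHS](bigID (fun j => j \in codom h))/= -[leLHS]addr0 lerD//.
  rewrite -big_uniq/=; last by rewrite map_inj_uniq ?enum_uniq.
  by rewrite big_map big_enum.
by apply: sumr_ge0 => j _; exact: f0.
Qed.

Section SVD.
Variables (m n : nat) (A : 'M[R]_(m, n)) (s : m.-tuple R).
Hypotheses (mn : (m <= n)%N) (hs : is_singular_values A s).
Let S : 'M[R]_(m, n) := \matrix_(i, j) (tnth s i *+ (i == j :> nat)).

Lemma singular_value_ge0 : 0 <= s`_0.
Proof.
case: hs => _ s0 _; case: (posnP m) => [m0|m0].
  by rewrite nth_default// size_tuple m0.
by have := s0 (Ordinal m0); rewrite (tnth_nth 0).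
Qed.

Lemma singular_value_le (i : 'I_m) : tnth s i <= s`_0.
Proof.
case: hs => ss _ _; rewrite (tnth_nth 0).
have tr : transitive (fun x y : R => y <= x) by move=> x y z xy yz; exact: le_trans yz xy.
have rr : reflexive (fun x y : R => y <= x) by move=> x; exact: lexx.
have m0 : (0 < m)%N by exact: leq_ltn_trans (ltn_ord i).
by apply: (sorted_leq_nth tr rr 0 ss); rewrite ?inE ?size_tuple.
Qed.

Lemma opbound_singular_value : opbound A s`_0.
Proof.
have s00 := singular_value_ge0.
case: (hs) => _ s0 [U [V [hU hV hA]]].
have hV' : (V^T)^T *m V^T = 1%:M by rewrite trmxK; exact: mulmx1C.
move=> x; rewrite -(ler_pXn2r (n := 2)) ?nnegrE ?mulr_ge0 ?norm2_ge0//.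
rewrite exprMn !norm2_sq hA -!mulmxA frob2_orthl//.
rewrite -(frob2_orthl x hV') !frob2_cV mulr_sumr.
set z := V^T *m x.
have Sz i : (S *m z) i 0 = tnth s i * z (widen_ord mn i) 0.
  rewrite mxE (bigD1 (widen_ord mn i))//= mxE eqxx mulr1n big1 ?addr0// => j ji.
  by rewrite mxE (negbTE (_ : (i != j :> nat))) ?mulr0n ?mul0r// eq_sym.
apply: (@le_trans _ _ (\sum_i s`_0 ^+ 2 * z (widen_ord mn i) 0 ^+ 2)).
  apply: ler_sum => i _; rewrite -/S Sz exprMn ler_wpM2r ?sqr_ge0//.
  by rewrite ler_pXn2r ?nnegrE// singular_value_le.
apply: (@ler_sum_inj _ _ (widen_ord mn) (fun j => s`_0 ^+ 2 * z j 0 ^+ 2)).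
  by move=> i j /(congr1 val)/= ij; exact/val_inj.
by move=> j; rewrite mulr_ge0 ?sqr_ge0.
Qed.

(** [V1] consists of the first [r] right singular vectors, which leaves only the singular values
    from index [r] on. *)
Lemma singular_tail r : (r <= m)%N -> exists V1 : 'M[R]_(n, r),
  V1^T *m V1 = 1%:M /\ frob2 (A - A *m V1 *m V1^T) = tail_sum s n r.
Proof.
move=> rm; have rn := leq_trans rm mn.
case: hs => _ _ [U [V [hU hV hA]]].
pose Pr : 'M[R]_(n, r) := pid_mx r.
exists (V *m Pr); split.
  rewrite trmx_mul /Pr tr_pid_mx mulmxA -(mulmxA _ V^T) hV mulmx1.
  by rewrite mul_pid_mx minnn (minn_idPr rn) pid_mx_1.
have -> : A - A *m (V *m Pr) *m (V *m Pr)^T =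
    U *m (S - S *m (pid_mx r : 'M[R]_n)) *m V^T.
  rewrite hA -/S trmx_mul /Pr tr_pid_mx mulmxBr mulmxBl; congr (_ - _).
  rewrite !mulmxA -(mulmxA _ V^T V) hV mulmx1 -(mulmxA _ (pid_mx r) (pid_mx r)).
  by rewrite mul_pid_mx minnn minnn -!mulmxA.
rewrite frob2_orthr// frob2_orthl//.
have entry i j : (S - S *m (pid_mx r : 'M[R]_n)) i j =
    tnth s i *+ ((i == j :> nat) && (r <= j)%N).
  rewrite mxE [X in _ + X]mxE [X in _ - X]mxE (bigD1 j)//= big1 ?addr0 => [|k kj].
    rewrite !mxE eqxx/=; case: (i == j :> nat); case: (ltnP j r) => _;
      by rewrite ?mulr1n ?mulr0n ?mulr1 ?mulr0 ?subrr ?subr0.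
  by rewrite !mxE (negbTE (_ : (k != j :> nat)))//= mulr0.
transitivity (\sum_(i < m | (r <= i)%N) s`_i ^+ 2).
  rewrite [RHS]big_mkcond; apply: eq_bigr => i _.
  rewrite (bigD1 (widen_ord mn i))//= entry eqxx big1 ?addr0 => [|j ji].
    by rewrite (tnth_nth 0) /=; case: (r <= i)%N; rewrite ?mulr1n// mulr0n expr0n.
  rewrite entry (negbTE (_ : (i != j :> nat)))/= ?mulr0n ?expr0n//.
  by rewrite eq_sym.
(* The one-based sum is shifted and cut at [m]; beyond [m] the default value of the sequence is
   0. *)
rewrite /tail_sum /lambda big_add1/= (@big_cat_nat _ _ _ m)//=.
rewrite [X in _ = _ + X]big_nat_cond [X in _ = _ + X]big1 ?addr0 => [|j].
  by rewrite big_geq_mkord.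
rewrite andbT => /andP[mj _].
by rewrite nth_default ?size_tuple// expr0n.
Qed.

End SVD.

Lemma ThetaHE (m : nat) (s : m.-tuple R) n r : lambda s r.+1 != 0 ->
  ThetaH s n r = (Num.sqrt (lambda s 1 / lambda s r.+1) * Num.sqrt (intdim s n r)
    + intdim s n r) * (4 * lambda s r.+1).
Proof.
move=> L0; have Lp : 0 < lambda s r.+1 by rewrite lt_def L0 sqr_ge0.
have l1 : 0 <= lambda s 1 / lambda s r.+1 by rewrite divr_ge0 ?sqr_ge0.
rewrite /ThetaH /intdim -sqrtrM// -mulr_sumr -/(tail_sum s n r).
have -> : lambda s 1 * tail_sum s n r = (lambda s 1 / lambda s r.+1 *
    (tail_sum s n r / lambda s r.+1)) * lambda s r.+1 ^+ 2 by field.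
have X0 : 0 <= lambda s 1 / lambda s r.+1 * (tail_sum s n r / lambda s r.+1).
  by rewrite mulr_ge0// divr_ge0 ?(ltW Lp)// sumr_ge0// => i _; exact: sqr_ge0.
rewrite (sqrtrM _ X0).
by rewrite sqrtr_sqr gtr0_norm//; field.
Qed.

(** The right-hand side is [gram_pert] at the squared error 4 tau: Theta is the deterministic bound
    evaluated at the bound for the mean squared error. *)
Lemma ThetaHE_tail (m : nat) (s : m.-tuple R) n r : 0 <= s`_0 -> 0 <= tail_sum s n r ->
  ThetaH s n r = 2 * s`_0 * Num.sqrt (4 * tail_sum s n r) + 4 * tail_sum s n r.
Proof.
move=> s0 t0; rewrite /ThetaH -mulr_sumr -/(tail_sum s n r) /lambda/= sqrtrM ?sqr_ge0//.
rewrite sqrtr_sqr ger0_norm// sqrtrM//.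
have -> : Num.sqrt 4 = 2 :> R by rewrite (_ : 4 = 2 ^+ 2) ?sqrtr_sqr ?ger0_norm//; ring.
by congr (_ + _); ring.
Qed.

End SingularValueTail.

(** * The mean squared error of the two-stage sketch *)

Section SketchExpectation.
Context (R : realType) (d : measure_display) (T : measurableType d).
Variable P : probability T R.

Lemma frob2_proj_le c N a (C : 'M[R]_(c, N)) (Q : 'M[R]_(N, a)) : Q^T *m Q = 1%:M ->
  frob2 (C - C *m Q *m Q^T) <= frob2 C.
Proof.
move=> hQ; pose D := C - C *m Q *m Q^T.
have hD : D *m Q = 0 by rewrite /D mulmxBl -!mulmxA hQ mulmx1 subrr.
have := frob2_frame (- (C *m Q)) hQ hD.
rewrite mulNmx opprK subrK => ->.
by rewrite lerDl frob2_ge0.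
Qed.

(* The range of [Q] contains that of [A X], so the orthogonal projection onto it
   does at least as well as any reconstruction from [A X]. *)
Lemma proj_le_sketch_cost m n l a b (A : 'M[R]_(m, n)) (X : 'M[R]_(n, l))
    (Q : 'M[R]_(m, a)) (V : 'M[R]_(n, b)) Z : Q^T *m Q = 1%:M -> A *m X = Q *m Z ->
  ((frob2 (A^T - A^T *m Q *m Q^T))%:E <= sketch_cost A V X)%E.
Proof.
move=> hQ hZ; rewrite /sketch_cost; case: ifP => _; first exact: leey.
rewrite lee_fin; set E := A - _.
pose Y := Z *m (X^T *m V) *m reg_inv 0 (X^T *m V) *m V^T.
have EY : E^T = A^T - Y^T *m Q^T.
  rewrite -trmx_mul -[RHS]linearB; congr ((_ - _)^T).
  by rewrite /Y hZ !mulmxA.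
have -> : A^T - A^T *m Q *m Q^T = E^T - E^T *m Q *m Q^T.
  rewrite EY !mulmxBl -(mulmxA Y^T) hQ mulmx1 opprB addrA subrK.
  by [].
by rewrite -(frob2_tr E) frob2_proj_le.
Qed.

Section TwoStages.
Variables (m n r : nat) (A : 'M[R]_(m, n)).
Variables (Omega : T -> 'M[R]_(n, 2 * r + 1)) (Psi : T -> 'M[R]_(m, 2 * (2 * r + 1) + 1)).
Variables (qf : 'M[R]_(m, 2 * r + 1) -> 'M[R]_(m, minn m (2 * r + 1))).
Variable V : 'M[R]_(n, r).
Hypotheses (gO : gmx P Omega) (gP : gmx P Psi) (iOP : independent_mx P Omega Psi).
Hypotheses (bqf : borel_fun qf) (hqf : forall Y, exists RY, thin_qr Y (qf Y) RY).
Hypotheses (r0 : (1 <= r)%N) (hV : V^T *m V = 1%:M).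

(** Off the singular event this is the squared error of [singleview]. The transpose turns
    [Q *m moore_penrose G *m Z^T] into the reconstruction of [A^T] from [A^T *m Psi]. *)
Definition two_stage_cost (z : mxT R n (2 * r + 1) * mxT R m (2 * (2 * r + 1) + 1)) :=
  sketch_cost A^T (qf (A *m z.1)) z.2.

Lemma measurable_two_stage_cost : measurable_fun setT two_stage_cost.
Proof.
have mqf : measurable_fun setT (qf : mxT R _ _ -> mxT R _ _).
  by move=> _ E mE; rewrite setTI; exact: bqf.
pose Q (z : mxT R n (2 * r + 1) * mxT R m (2 * (2 * r + 1) + 1)) := qf (A *m z.1).
have mQ : measurable_fun setT (Q : _ -> mxT R _ _).
  apply: (measurableT_comp mqf); apply: measurable_mulmx; first exact: measurable_cst.
  exact: measurable_fst.
have mz2 : measurable_fun setT (snd : mxT R n (2 * r + 1) * mxT R m (2 * (2 * r + 1) + 1) -> _).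
  exact: measurable_snd.
have mG : measurable_fun setT
    (fun z : mxT R n (2 * r + 1) * mxT R m (2 * (2 * r + 1) + 1) =>
      (z.2 : 'M[R]_(m, 2 * (2 * r + 1) + 1))^T *m Q z : mxT R _ _).
  by apply: measurable_mulmx => //; exact: measurable_trmx.
apply: measurable_fun_ifT => //.
  apply: measurable_fun_eqr => //; apply: measurable_det.
  exact: (measurable_reg_gram 0 mG).
apply/measurable_EFinP; apply: measurable_frob2.
apply: measurable_mxadd; first exact: measurable_cst.
apply: measurable_mxopp; apply: measurable_mulmx; last exact: measurable_trmx.
apply: measurable_mulmx; last exact: measurable_reg_inv.
apply: measurable_mulmx => //; apply: measurable_mulmx => //; exact: measurable_cst.
Qed.

Lemma two_stage_cost_mean :
  (\int[P]_w two_stage_cost (Omega w, Psi w) <=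
   (4 * frob2 (A - A *m V *m V^T))%:E)%E.
Proof.
have mO := gmx_measurable gO; have mP := gmx_measurable gP.
have mc := measurable_two_stage_cost.
have c0 z : (0 <= two_stage_cost z)%E by exact: sketch_cost_ge0.
rewrite (indep_integral mO mP iOP mc c0).
have mcost : measurable_fun setT (fun w => sketch_cost A V (Omega w)).
  apply: measurable_fun_ifT => //.
    apply: measurable_fun_eqr => //; apply: measurable_det.
    apply: (@measurable_reg_gram _ _ _ _ _ 0 (fun w => (Omega w)^T *m V)).
    by apply: measurable_mulmx; [exact: measurable_trmx|exact: measurable_cst].
  apply/measurable_EFinP; apply: measurable_frob2.
  apply: measurable_mxadd; first exact: measurable_cst.
  apply: measurable_mxopp; apply: measurable_mulmx; last exact: measurable_cst.
  have mG : measurable_fun setT (fun w => (Omega w)^T *m V : mxT R _ _).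
    by apply: measurable_mulmx; [exact: measurable_trmx|exact: measurable_cst].
  apply: measurable_mulmx; last exact: measurable_reg_inv.
  by apply: measurable_mulmx => //; apply: measurable_mulmx => //; exact: measurable_cst.
have cost0 w : (0 <= sketch_cost A V (Omega w))%E by exact: sketch_cost_ge0.
apply: (@le_trans _ _ (\int[P]_w (2%:E * sketch_cost A V (Omega w)))%E).
  apply: ge0_le_integral => //.
  - by move=> w _; exact: integral_ge0.
  - have mc' : measurable_fun setT (fun z : T * T => two_stage_cost (Omega z.1, Psi z.2)).
      apply: (measurableT_comp mc); apply: measurable_fun_pair.
        exact: (measurableT_comp mO).
      exact: (measurableT_comp mP).
    exact: (@measurable_fun_fubini_tonelli_F _ _ _ _ _ P _ mc').
  - exact: emeasurable_funM.
  move=> w _; have [Z [hQ _ hZ]] := hqf (A *m Omega w).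
  set l1 := (2 * r + 1)%N in hQ hZ *.
  (* With a = min(m, l1) columns, k + 1 = 2 l1 - a >= l1 >= a, so the factor 1 + a / (k + 1) is at
     most 2. *)
  pose k := (2 * l1 + 1 - minn m l1 - 2)%N.
  have l1k : (l1 <= k.+1)%N by rewrite /k; lia.
  have kE : (2 * l1 + 1 = minn m l1 + k.+2)%N by rewrite /k; lia.
  apply: (le_trans (sketch_cost_mean _ gP hQ kE)).
  have Fle := proj_le_sketch_cost V hQ hZ.
  apply: (@le_trans _ _ (2%:E * (frob2 (A^T - A^T *m qf (A *m Omega w) *m (qf (A *m Omega w))^T))%:E)%E).
    rewrite -EFinM lee_fin ler_wpM2r ?frob2_ge0//.
    rewrite -lerBrDl (_ : 2 - 1 = 1); last by ring.
    rewrite ler_pdivrMr// mul1r ler_nat.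
    exact: leq_trans (geq_minr _ _) l1k.
  by rewrite lee_wpmul2l.
rewrite ge0_integralZl_EFin//.
(* Here the ratio is r / r, so the first sketch contributes exactly the factor 2. *)
have rE : (2 * r + 1 = r + r.-1.+2)%N by lia.
apply: (@le_trans _ _ (2%:E * ((1 + r%:R / r.-1.+1%:R) * frob2 (A - A *m V *m V^T))%:E)%E).
  by rewrite lee_wpmul2l// (sketch_cost_mean _ gO hV rE).
rewrite prednK// divff ?pnatr_eq0 -?lt0n// -EFinM lee_fin le_eqVlt.
by apply/orP; left; apply/eqP; ring.
Qed.

End TwoStages.
End SketchExpectation.

(** * From the mean squared error to the two bounds *)

Theorem theorem3 (R : realType) (d : measure_display) (T : measurableType d)
    (P : probability T R) (m n r : nat)
    (A : 'M[R]_(m, n)) (s : m.-tuple R) (Gamma : 'M[R]_n) (g : 'cV[R]_n)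
    (Omega : T -> 'M[R]_(n, 2 * r + 1))
    (Psi : T -> 'M[R]_(m, 2 * (2 * r + 1) + 1))
    (qf : 'M[R]_(m, 2 * r + 1) -> 'M[R]_(m, minn m (2 * r + 1)))
    (dx : 'cV[R]_n) (dxhat : T -> 'cV[R]_n) :
  let H := A^T *m A in
  let Ahat := fun w => singleview A qf (Omega w) (Psi w) in
  let Hhat := fun w => (Ahat w)^T *m Ahat w in
  (m <= n)%N ->
  is_singular_values A s ->
  (1 <= r)%N -> (r <= m)%N -> lambda s r.+1 != 0 ->
  spdmx Gamma -> g != 0 ->
  std_gaussian_mx P Omega -> std_gaussian_mx P Psi ->
  independent_mx P Omega Psi ->
  borel_fun qf ->
  (forall Y, exists RY, thin_qr Y (qf Y) RY) ->
  gn_hessian Gamma H *m dx = - g ->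
  (forall w, gn_hessian Gamma (Hhat w) *m dxhat w = - g) ->
  [/\ ThetaH s n r =
        (Num.sqrt (lambda s 1 / lambda s r.+1) * Num.sqrt (intdim s n r)
         + intdim s n r) * (4 * lambda s r.+1),
      ('E_P[fun w => (normM (invmx Gamma) (dx - dxhat w)
                      / normM (invmx Gamma) dx)%R]
         <= (ThetaH s n r)%:E)%E &
      ('E_P[fun w => Num.sqrt (kappa2 (precond H (Hhat w)))]
         <= (1 + ThetaH s n r)%:E)%E].
Proof.
move=> H Ahat Hhat mn hs r1 rm L0 hG g0 /std_gaussian_gmx gO.
move=> /std_gaussian_gmx gP iOP bqf hqf hdx hdxhat.
have s0 := singular_value_ge0 hs.
have hA := opbound_singular_value mn hs.
have [V [hV tailE]] := singular_tail mn hs rm.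
set tau := tail_sum s n r in tailE *.
have tau_ge0 : 0 <= tau by rewrite -tailE frob2_ge0.
(* For r >= m the default value would make lambda_(r+1) zero. *)
have rm1 : (r < m)%N.
  rewrite ltnNge; apply: contra L0 => mr.
  by rewrite /lambda/= nth_default ?size_tuple// expr0n.
have tau0 : 0 < tau.
  rewrite /tau /tail_sum big_ltn ?ltnS ?(leq_trans rm1)//.
  apply: ltr_pwDl; first by rewrite lt_def L0 sqr_ge0.
  by apply: sumr_ge0 => i _; exact: sqr_ge0.
(* AM-GM is applied at this point because it is sharp when e = t^2, the bound on the mean: s_1 t + c
   t^2 = 2 s_1 t + t^2, which is Theta. *)
pose t := Num.sqrt (4 * tau).
have t0 : 0 < t by rewrite sqrtr_gt0 mulr_gt0.
have t2 : t ^+ 2 = 4 * tau by rewrite sqr_sqrtr// mulr_ge0.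
pose c := s`_0 / t + 1.
have c0 : 0 < c by rewrite ltr_wpDl// divr_ge0// ltW.
pose F w : \bar R := two_stage_cost A qf (Omega w, Psi w).
have F0 w : (0 <= F w)%E by exact: sketch_cost_ge0.
have mF : measurable_fun [set: T] F.
  apply: (measurableT_comp (measurable_two_stage_cost A bqf)).
  by apply: measurable_fun_pair; [exact: (gmx_measurable gO)|exact: (gmx_measurable gP)].
have EF : (\int[P]_w F w <= (4 * tau)%:E)%E.
  by rewrite -tailE; exact: two_stage_cost_mean.
pose D w := gram_pert s`_0 (frob2 (A - Ahat w)).
(* AM-GM: 2 sqrt e <= e / t + t with e the squared error. *)
have DF w : ((D w)%:E <= (s`_0 * t)%:E + c%:E * F w)%E.
  rewrite /F /two_stage_cost /sketch_cost /=; case: ifPn => [_|hdet].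
    (* On the singular event the right-hand side is infinite, as c > 0. *)
    by rewrite gt0_muley ?lte_fin// addey// leey.
  have [Z [hQ _ _]] := hqf (A *m Omega w).
  set e := frob2 (A^T - _).
  have eE : frob2 (A - Ahat w) = e.
    rewrite -frob2_tr /e linearB/=; congr (frob2 (_ - _)).
    rewrite /Ahat /singleview moore_penrose_full// !trmx_mul !trmxK reg_inv_tr.
    by rewrite !mulmxA.
  have e0 : 0 <= e by exact: frob2_ge0.
  rewrite -EFinM -EFinD lee_fin /D eE /gram_pert.
  have amgm : 2 * Num.sqrt e <= e / t + t.
    rewrite -(ler_pM2r t0) [leRHS]mulrDl divfK ?gt_eqF// -expr2.
    rewrite -[X in _ <= X + _](sqr_sqrtr e0).
    by have := sqr_ge0 (Num.sqrt e - t); rewrite sqrrB; lra.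
  have -> : s`_0 * t + c * e = s`_0 * (e / t + t) + e by rewrite /c; ring.
  by rewrite lerD2r -mulrA mulrCA ler_wpM2l.
(* Used with a = 0 for the solution error and a = 1 for the condition number. *)
have EDF (a : R) : 0 <= a ->
    (\int[P]_w (a%:E + ((s`_0 * t)%:E + c%:E * F w)) <= (a + ThetaH s n r)%:E)%E.
  move=> a0; have st0 : 0 <= s`_0 * t by rewrite mulr_ge0// ltW.
  have mcF : measurable_fun [set: T] (fun w => c%:E * F w)%E by exact: emeasurable_funM.
  have cF0 w : (0 <= c%:E * F w)%E by rewrite mule_ge0// lee_fin ltW.
  have Ecst (b : R) : (\int[P]_w b%:E = b%:E)%E.
    rewrite integral_cst//.
    by apply: (etrans (congr1 (mule b%:E) (probability_setT P))); rewrite mule1.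
  rewrite ge0_integralD//; last 2 first.
  - by move=> w _; rewrite adde_ge0.
  - exact: emeasurable_funD.
  rewrite ge0_integralD// !Ecst [leRHS]EFinD leeD2l// ge0_integralZl_EFin//; last exact: ltW.
  apply: (@le_trans _ _ ((s`_0 * t)%:E + c%:E * (4 * tau)%:E)%E).
    by rewrite leeD2l// lee_wpmul2l// lee_fin ltW.
  rewrite -EFinM -EFinD lee_fin ThetaHE_tail// -/tau -/t -t2 /c.
  by rewrite le_eqVlt; apply/orP; left; apply/eqP; field; rewrite gt_eqF.
have D0 w : 0 <= D w by rewrite gram_pert_ge0// frob2_ge0.
split; first exact: ThetaHE.
- apply: (@le_trans _ _ (\int[P]_w (0%:E + ((s`_0 * t)%:E + c%:E * F w)))%E); last first.
    by apply: le_trans (EDF 0 (lexx _)) _; rewrite add0r.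
  apply: le_expectation_dominated => w; first by rewrite divr_ge0// norm2_ge0.
  rewrite add0e; apply: le_trans (DF w); rewrite lee_fin.
  exact: (solution_error s0 hA hG hdx (hdxhat w)).
- apply: le_trans (EDF 1 ler01).
  apply: le_expectation_dominated => w; first exact: sqrtr_ge0.
  apply: (@le_trans _ _ (1 + D w)%:E); last by rewrite EFinD leeD2l// DF.
  by rewrite lee_fin; exact: (sqrt_kappa_precond _ s0 hA).
Qed.
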